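(* The following hold in $\mathbf{ZF}$. (a) For every quasi-metric space $\mathbf{X}=\langle X,d\rangle$ such that $\langle X,\tau(d)\rangle$ is compact and Hausdorff, the following are equivalent: (i) $\mathbf{X}$ is Loeb; (ii) $\langle X,d^{-1}\rangle$ is separable; (iii) $\mathbf{X}$ and $\langle X,d^{-1}\rangle$ are both separable; (iv) $\mathbf{X}$ is second-countable. In particular, every compact, Hausdorff, quasi-metrizable Loeb space is metrizable. (b) $\mathbf{CAC}$ implies that every compact, Hausdorff, quasi-metrizable space is metrizable.
   Context: The theory is $\mathbf{ZF}$ (no choice). A quasi-metric on $X$ is $d:X\times X\to[0,+\infty)$ with $d(x,x)=0$, $d(x,y)\le d(x,z)+d(z,y)$, and $d(x,y)=0\Rightarrow x=y$; its conjugate is $d^{-1}(x,y)=d(y,x)$. The topology $\tau(d)$ induced by $d$ consists of all $V\subseteq X$ such that for every $x\in V$ there is $n\in\omega$ with $\{y\in X: d(x,y)<2^{-n}\}\subseteq V$. Topological properties of a quasi-metric space $\langle X,d\rangle$ (resp. $\langle X,d^{-1}\rangle$) refer to $\tau(d)$ (resp. $\tau(d^{-1})$). A space is quasi-metrizable if its topology equals $\tau(d)$ for some quasi-metric $d$. A space is Loeb if it is empty or the family of all its non-empty closed subsets has a choice function. A space is separable if it has a countable dense subset. $\mathbf{CAC}$: every denumerable family of non-empty sets has a choice function. *)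

(* Defs.v *)
(* "Provable in ZF" is rendered as "true in every first-order model of ZF".
   Rocq's own choice principles then say nothing about choice functions inside
   the model: these must be sets of the model, and the only sets known to exist
   are those given by the ZF axioms. *)
From Stdlib Require Import ClassicalEpsilon.

Set Implicit Arguments.
Unset Strict Implicit.
Unset Printing Implicit Defensive.

(* First-order formulas over {∈, =}; variables are de Bruijn indices. *)
Inductive formula : Type :=
| FMem (i j : nat)
| FEq (i j : nat)
| FNot (phi : formula)
| FAnd (phi psi : formula)
| FAll (phi : formula).

Definition scons (V : Type) (x : V) (e : nat -> V) (n : nat) : V :=
  match n with 0 => x | S k => e k end.

Fixpoint sat (V : Type) (E : V -> V -> Prop) (e : nat -> V) (phi : formula)
  : Prop :=
  match phi with
  | FMem i j => E (e i) (e j)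
  | FEq i j => e i = e j
  | FNot p => ~ sat E e p
  | FAnd p q => sat E e p /\ sat E e q
  | FAll p => forall x, sat E (scons x e) p
  end.

(* The schemas range over formulas with parameters (given by the environment)
   and not over all Rocq predicates: second-order schemas would force choice
   into the model. *)
Record ZF_model : Type := {
  carrier :> Type;
  mem : carrier -> carrier -> Prop;
  zf_extensionality : forall a b,
    (forall x, mem x a <-> mem x b) -> a = b;
  zf_foundation : forall a,
    (exists x, mem x a) -> exists x, mem x a /\ forall y, mem y x -> ~ mem y a;
  zf_pairing : forall a b, exists c, forall x, mem x c <-> x = a \/ x = b;
  zf_union : forall a, exists b, forall x,
    mem x b <-> exists y, mem y a /\ mem x y;
  zf_power : forall a, exists b, forall x,
    mem x b <-> forall y, mem y x -> mem y a;
  zf_infinity : exists w,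
    (exists z, mem z w /\ forall x, ~ mem x z) /\
    (forall x, mem x w ->
       exists y, mem y w /\ forall z, mem z y <-> mem z x \/ z = x);
  zf_separation : forall (phi : formula) (e : nat -> carrier) a,
    exists b, forall x, mem x b <-> mem x a /\ sat mem (scons x e) phi;
  zf_replacement : forall (phi : formula) (e : nat -> carrier) a,
    (forall x y y', mem x a ->
       sat mem (scons y (scons x e)) phi ->
       sat mem (scons y' (scons x e)) phi -> y = y') ->
    exists b, forall y,
      mem y b <-> exists x, mem x a /\ sat mem (scons y (scons x e)) phi
}.

Arguments mem {z} _ _.

Declare Scope zf_scope.
Delimit Scope zf_scope with zf.
Open Scope zf_scope.

Notation "x ∈ y" := (mem x y) (at level 70, no associativity) : zf_scope.

Lemma ZF_model_inhabited (M : ZF_model) : inhabited M.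
Proof. destruct (zf_infinity M) as [w _]; exact (inhabits w). Qed.

(* Definite description; it is used only where existence and uniqueness
   follow from the axioms of ZF. *)
Definition iota (M : ZF_model) (P : M -> Prop) : M :=
  epsilon (ZF_model_inhabited M) P.

(* The set {x | P x}; meaningful only when that class is a set of the model. *)
Definition compr (M : ZF_model) (P : M -> Prop) : M :=
  iota (fun a => forall x, x ∈ a <-> P x).

Notation "{{ x | P }}" := (compr (fun x => P))
  (at level 0, x binder, P at level 200) : zf_scope.

Section SetTheory.
Variable M : ZF_model.
Implicit Types a b f x y n X T d : M.

Definition subset a b : Prop := forall x, x ∈ a -> x ∈ b.
Definition nonempty a : Prop := exists x, x ∈ a.

Definition empty : M := {{ x | False }}.
Definition upair a b : M := {{ x | x = a \/ x = b }}.
Definition opair a b : M := upair (upair a a) (upair a b).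
Definition bigunion a : M := {{ x | exists y, y ∈ a /\ x ∈ y }}.
Definition power a : M := {{ x | subset x a }}.
Definition inter a b : M := {{ x | x ∈ a /\ x ∈ b }}.
Definition diff a b : M := {{ x | x ∈ a /\ ~ x ∈ b }}.
Definition prod a b : M :=
  {{ p | exists x y, x ∈ a /\ y ∈ b /\ p = opair x y }}.

Definition succ n : M := {{ x | x ∈ n \/ x = n }}.
Definition inductive_set a : Prop :=
  empty ∈ a /\ forall n, n ∈ a -> succ n ∈ a.
Definition omega : M := {{ n | forall a, inductive_set a -> n ∈ a }}.

Definition is_fun f a b : Prop :=
  subset f (prod a b) /\ forall x, x ∈ a -> exists! y, opair x y ∈ f.
Definition app f x : M := iota (fun y => opair x y ∈ f).
Definition bijection f a b : Prop :=
  is_fun f a b /\ forall y, y ∈ b -> exists! x, opair x y ∈ f.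

Definition equipotent a b : Prop := exists f, bijection f a b.
Definition finite_set a : Prop := exists n, n ∈ omega /\ equipotent a n.
Definition denumerable a : Prop := equipotent a omega.
Definition countable a : Prop := exists b, subset b omega /\ equipotent a b.

Definition choice_function f F : Prop :=
  is_fun f F (bigunion F) /\ forall a, a ∈ F -> app f a ∈ a.

Definition CAC : Prop :=
  forall F : M, denumerable F -> (forall a, a ∈ F -> nonempty a) ->
  exists f, choice_function f F.

Definition is_topology X T : Prop :=
  (forall U, U ∈ T -> subset U X) /\
  empty ∈ T /\ X ∈ T /\
  (forall U V, U ∈ T -> V ∈ T -> inter U V ∈ T) /\
  (forall F, subset F T -> bigunion F ∈ T).

Definition compact X T : Prop :=
  forall F, subset F T -> subset X (bigunion F) ->
  exists G, subset G F /\ finite_set G /\ subset X (bigunion G).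

Definition hausdorff X T : Prop :=
  forall x y, x ∈ X -> y ∈ X -> x <> y ->
  exists U V, U ∈ T /\ V ∈ T /\ x ∈ U /\ y ∈ V /\ ~ nonempty (inter U V).

Definition closed X T a : Prop := subset a X /\ diff X a ∈ T.

Definition loeb X T : Prop :=
  X = empty \/
  exists f, choice_function f {{ a | closed X T a /\ nonempty a }}.

Definition dense X T a : Prop :=
  subset a X /\ forall U, U ∈ T -> nonempty U -> nonempty (inter U a).

Definition separable X T : Prop := exists a, countable a /\ dense X T a.

Definition is_base T B : Prop :=
  subset B T /\
  forall U x, U ∈ T -> x ∈ U -> exists W, W ∈ B /\ x ∈ W /\ subset W U.

Definition second_countable T : Prop := exists B, countable B /\ is_base T B.

End SetTheory.

(* The real numbers of the model, given up to isomorphism as a Dedekind-complete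
   ordered field: operations and order are sets of the model, and completeness
   is about subsets that belong to the model. *)
Record field_data (M : ZF_model) : Type := {
  Rset : M;
  Rzero : M;
  Rone : M;
  Radd : M;
  Rmul : M;
  Rle_rel : M
}.

Section Reals.
Variables (M : ZF_model) (K : field_data M).
Implicit Types x y z u : M.

Definition radd x y : M := app (Radd K) (opair x y).
Definition rmul x y : M := app (Rmul K) (opair x y).
Definition rle x y : Prop := opair x y ∈ Rle_rel K.
Definition rlt x y : Prop := rle x y /\ x <> y.

Definition upper_bound a u : Prop :=
  u ∈ Rset K /\ forall x, x ∈ a -> rle x u.

Record complete_ordered_field : Prop := {
  Rzero_in : Rzero K ∈ Rset K;
  Rone_in : Rone K ∈ Rset K;
  Radd_fun : is_fun (Radd K) (prod (Rset K) (Rset K)) (Rset K);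
  Rmul_fun : is_fun (Rmul K) (prod (Rset K) (Rset K)) (Rset K);
  Rle_sub : subset (Rle_rel K) (prod (Rset K) (Rset K));
  RaddA : forall x y z, x ∈ Rset K -> y ∈ Rset K -> z ∈ Rset K ->
    radd x (radd y z) = radd (radd x y) z;
  RaddC : forall x y, x ∈ Rset K -> y ∈ Rset K -> radd x y = radd y x;
  Radd0 : forall x, x ∈ Rset K -> radd x (Rzero K) = x;
  RaddN : forall x, x ∈ Rset K ->
    exists y, y ∈ Rset K /\ radd x y = Rzero K;
  RmulA : forall x y z, x ∈ Rset K -> y ∈ Rset K -> z ∈ Rset K ->
    rmul x (rmul y z) = rmul (rmul x y) z;
  RmulC : forall x y, x ∈ Rset K -> y ∈ Rset K -> rmul x y = rmul y x;
  Rmul1 : forall x, x ∈ Rset K -> rmul x (Rone K) = x;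
  RmulV : forall x, x ∈ Rset K -> x <> Rzero K ->
    exists y, y ∈ Rset K /\ rmul x y = Rone K;
  RmulD : forall x y z, x ∈ Rset K -> y ∈ Rset K -> z ∈ Rset K ->
    rmul x (radd y z) = radd (rmul x y) (rmul x z);
  Rone_neq0 : Rone K <> Rzero K;
  Rle_total : forall x y, x ∈ Rset K -> y ∈ Rset K -> rle x y \/ rle y x;
  Rle_antisym : forall x y, rle x y -> rle y x -> x = y;
  Rle_trans : forall x y z, rle x y -> rle y z -> rle x z;
  Rle_add : forall x y z, z ∈ Rset K -> rle x y -> rle (radd x z) (radd y z);
  Rle_mul : forall x y, rle (Rzero K) x -> rle (Rzero K) y ->
    rle (Rzero K) (rmul x y);
  Rle_sup : forall a, subset a (Rset K) -> nonempty a ->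
    (exists u, upper_bound a u) ->
    exists s, upper_bound a s /\ forall u, upper_bound a u -> rle s u
}.

Definition Rnonneg : M := {{ x | x ∈ Rset K /\ rle (Rzero K) x }}.

(* The sequence n ↦ 2^{-n} on the model's ω, as a set of the model. *)
Definition halves : M :=
  iota (fun h => is_fun h (omega M) (Rset K) /\ app h (empty M) = Rone K /\
    forall n, n ∈ omega M -> radd (app h (succ n)) (app h (succ n)) = app h n).
Definition pow2neg (n : M) : M := app halves n.

Section QuasiMetric.
Variables (X d : M).

Definition dist x y : M := app d (opair x y).

Definition quasi_metric : Prop :=
  is_fun d (prod X X) Rnonneg /\
  (forall x, x ∈ X -> dist x x = Rzero K) /\
  (forall x y z, x ∈ X -> y ∈ X -> z ∈ X ->
     rle (dist x y) (radd (dist x z) (dist z y))) /\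
  (forall x y, x ∈ X -> y ∈ X -> dist x y = Rzero K -> x = y).

Definition metric : Prop :=
  quasi_metric /\ forall x y, x ∈ X -> y ∈ X -> dist x y = dist y x.

Definition conjugate : M :=
  {{ p | exists x y, x ∈ X /\ y ∈ X /\ p = opair (opair x y) (dist y x) }}.

Definition ball x n : M := {{ y | y ∈ X /\ rlt (dist x y) (pow2neg n) }}.

Definition tau : M :=
  {{ V | subset V X /\
         forall x, x ∈ V -> exists n, n ∈ omega M /\ subset (ball x n) V }}.

End QuasiMetric.

Definition quasi_metrizable (X T : M) : Prop :=
  exists d, quasi_metric X d /\ T = tau X d.

Definition metrizable (X T : M) : Prop :=
  exists d, metric X d /\ T = tau X d.

End Reals.

(* Main.v *)
(** A decreasing sequence of non-empty sets [C n] has a cluster point in a compact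
    space without any choice. Taking [C n] to be the points [x] outside an open
    [U] with [d(x,y) < 2^-n], where [y] is in [U], shows that every neighbourhood
    of [y] contains all [x] with [d(x,y)] small; so the topology of the conjugate
    is finer, and if [D] is dense for it, the balls with centres in [D] form a
    base. Given a countable base, a closed set is cut down to one of its points
    by intersecting it successively with closures of basic sets, which is a Loeb
    function. Conversely a Loeb function picks centres greedily: if [x] is such
    that removing [B(x,n+1)] decreases the number of [(n+1)]-balls needed to cover
    what is left, then so does removing [B(z,n)] for [z] in the closure of the set
    of these [x], so finitely many canonical centres suffice for each [n].

    Metrizability needs neither a Loeb function nor CAC: by two cluster point
    arguments the relations [exists z, d(z,x) < 2^-n and d(z,y) < 2^-n] form a
    countable base of a uniformity inducing the topology, and Frink's chain
    construction for a subsequence of them gives a metric. *)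

Require Import Defs.
From Stdlib Require Import ClassicalEpsilon Arith.

Set Implicit Arguments.
Unset Strict Implicit.

(** * Definability over a model of ZF *)

Section Definability.
Variable M : ZF_model.

(** Separation inside the model, and with it induction on its [omega], is available only for
    first-order definable predicates, and that [omega] may be non-standard. So every induction and
    recursion runs inside the model on a predicate proved definable, and sequences, finite covers
    and sums are given by their graphs or as what lies in every closed family, never by Rocq
    functions on [nat].

    Choice is avoided in three ways. A sequence of counterexamples is replaced by the decreasing
    sets of all counterexamples, of which compactness yields one cluster point. A witness index in
    [omega] is replaced by the least one. A chosen path is replaced by an infimum over all chains.

    In the greedy argument the good centres need not form a closed set, so a Loeb function can only
    be applied to their closure; this is why radii are enlarged from n+1 to n. For the metric, a
    quasi-metric ball condition is not symmetric; requiring a common centre z makes it so, and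
    Hausdorffness is then what allows two such relations to be composed. *)

Lemma sat_ext (phi : formula) : forall e e' : nat -> M,
  (forall n, e n = e' n) -> (sat mem e phi <-> sat mem e' phi).
Proof.
  induction phi as [i j|i j|p IH|p IHp q IHq|p IH]; intros e e' H; simpl.
  - now rewrite !H.
  - now rewrite !H.
  - now rewrite (IH e e' H).
  - now rewrite (IHp e e' H), (IHq e e' H).
  - assert (Hx : forall x n, scons x e n = scons x e' n)
      by (intros x [|n]; simpl; auto).
    split; intros Hs x; apply (IH _ _ (Hx x)), Hs.
Qed.

Definition lift (f : nat -> nat) (n : nat) : nat :=
  match n with 0 => 0 | S k => S (f k) end.

Fixpoint rename (f : nat -> nat) (phi : formula) : formula :=
  match phi with
  | FMem i j => FMem (f i) (f j)
  | FEq i j => FEq (f i) (f j)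
  | FNot p => FNot (rename f p)
  | FAnd p q => FAnd (rename f p) (rename f q)
  | FAll p => FAll (rename (lift f) p)
  end.

Lemma sat_rename (phi : formula) : forall f (e : nat -> M),
  sat mem e (rename f phi) <-> sat mem (fun n => e (f n)) phi.
Proof.
  induction phi as [i j|i j|p IH|p IHp q IHq|p IH]; intros f e; simpl.
  - reflexivity.
  - reflexivity.
  - now rewrite IH.
  - now rewrite IHp, IHq.
  - split; intros H x; specialize (H x).
    + rewrite IH in H; revert H; apply sat_ext; now intros [|n].
    + rewrite IH; revert H; apply sat_ext; now intros [|n].
Qed.

Definition code (s : nat + nat) : nat :=
  match s with inl k => 2 * k | inr k => 2 * k + 1 end.
Definition decode (n : nat) : nat + nat :=
  if Nat.even n then inl (Nat.div2 n) else inr (Nat.div2 n).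

Lemma codeK s : decode (code s) = s.
Proof.
  destruct s as [k|k]; unfold decode, code.
  - rewrite Nat.even_mul; cbn [Nat.even orb]; now rewrite Nat.div2_double.
  - rewrite Nat.even_add, Nat.even_mul; cbn [Nat.even orb Bool.eqb].
    rewrite Nat.add_1_r; now rewrite Nat.div2_succ_double.
Qed.

(* Even indices are variables, odd ones are parameters from the model. Having
   infinitely many of both makes the parameters of two formulas easy to merge. *)
Definition merge (e c : nat -> M) (n : nat) : M :=
  match decode n with inl k => e k | inr k => c k end.

Lemma merge_code e c s :
  merge e c (code s) = match s with inl k => e k | inr k => c k end.
Proof. unfold merge; now rewrite codeK. Qed.

(* The axiom schemas apply to these predicates only, hence the definability
   lemmas below; [defn] proves them by recursion on the body of the predicate. *)
Definition definable (P : (nat -> M) -> Prop) : Prop :=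
  exists phi c, forall e, P e <-> sat mem (merge e c) phi.

(** The value sits at index 0 of the environment, so that a quantifier can bind it. *)
Definition definable_fun (F : (nat -> M) -> M) : Prop :=
  definable (fun e => e 0 = F (fun n => e (S n))).

Lemma def_ext (P Q : (nat -> M) -> Prop) :
  (forall e, Q e <-> P e) -> definable P -> definable Q.
Proof.
  intros H (phi & c & Hp); exists phi, c; intros e; now rewrite H.
Qed.

Lemma def_not (P : (nat -> M) -> Prop) :
  definable P -> definable (fun e => ~ P e).
Proof.
  intros (phi & c & H); exists (FNot phi), c; intros e; simpl; now rewrite H.
Qed.

Lemma def_and (P Q : (nat -> M) -> Prop) :
  definable P -> definable Q -> definable (fun e => P e /\ Q e).
Proof.
  intros (phi & c & H) (psi & c' & H').
  (* Variables stay in place; parameter [k] of either formula moves to the even or odd half of the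
     merged parameter sequence. *)
  set (inj := fun (h : nat -> nat + nat) n =>
     match decode n with inl k => code (inl k)
                       | inr k => code (inr (code (h k))) end).
  exists (FAnd (rename (inj inl) phi) (rename (inj inr) psi)), (merge c c').
  intros e; simpl; rewrite !sat_rename, H, H'.
  assert (E : forall n, merge e (merge c c') (inj inl n) = merge e c n)
    by (intros n; unfold inj, merge at 3; destruct (decode n);
        rewrite ?merge_code; reflexivity).
  assert (E' : forall n, merge e (merge c c') (inj inr n) = merge e c' n)
    by (intros n; unfold inj, merge at 3; destruct (decode n);
        rewrite ?merge_code; reflexivity).
  now rewrite (sat_ext phi E), (sat_ext psi E').
Qed.

Lemma def_rename (g : nat -> nat) (P : (nat -> M) -> Prop) :
  definable P -> definable (fun e => P (fun n => e (g n))).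
Proof.
  intros (phi & c & H).
  exists (rename (fun n => match decode n with inl k => code (inl (g k))
                                          | inr k => code (inr k) end) phi), c.
  intros e; rewrite sat_rename, H; apply sat_ext; intros n.
  unfold merge at 1; destruct (decode n); now rewrite merge_code.
Qed.

Lemma def_all (P : M -> (nat -> M) -> Prop) :
  definable (fun e => P (e 0) (fun n => e (S n))) ->
  definable (fun e => forall x, P x e).
Proof.
  intros (phi & c & H).
  (* Variable 0 becomes the bound index 0. All other indices are shifted past the binder, and
     variable [S k] becomes the outer variable [k]. *)
  set (f := fun n => match decode n with
     | inl 0 => 0 | inl (S k) => S (code (inl k)) | inr k => S (code (inr k)) end).
  exists (FAll (rename f phi)), c; intros e; simpl.
  assert (E : forall x, sat mem (scons x (merge e c)) (rename f phi) <-> P x e).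
  { intros x; rewrite sat_rename, (H (scons x e)); apply sat_ext; intros n.
    unfold f, merge at 2; destruct (decode n) as [[|k]|k]; cbn [scons];
      rewrite ?merge_code; reflexivity. }
  split; intros Hx x; apply E, Hx.
Qed.

Lemma def_imp (P Q : (nat -> M) -> Prop) :
  definable P -> definable Q -> definable (fun e => P e -> Q e).
Proof.
  intros HP HQ; apply def_ext with (fun e => ~ (P e /\ ~ Q e)).
  - intros e; destruct (classic (Q e)); tauto.
  - now apply def_not, def_and, def_not.
Qed.

Lemma def_or (P Q : (nat -> M) -> Prop) :
  definable P -> definable Q -> definable (fun e => P e \/ Q e).
Proof.
  intros HP HQ; apply def_ext with (fun e => ~ P e -> Q e).
  - intros e; destruct (classic (P e)); tauto.
  - now apply def_imp; [apply def_not|].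
Qed.

Lemma def_iff (P Q : (nat -> M) -> Prop) :
  definable P -> definable Q -> definable (fun e => P e <-> Q e).
Proof. intros HP HQ; apply def_and; now apply def_imp. Qed.

Lemma def_ex (P : M -> (nat -> M) -> Prop) :
  definable (fun e => P (e 0) (fun n => e (S n))) ->
  definable (fun e => exists x, P x e).
Proof.
  intros HP; apply def_ext with (fun e => ~ forall x, ~ P x e).
  - intros e; split; [intros [x Hx] H; now apply (H x)|].
    intros H; apply NNPP; intros H'; apply H; intros x Hx; apply H'; now exists x.
  - now apply def_not, (def_all (P := fun x e => ~ P x e)), def_not.
Qed.

(** By excluded middle a proposition without variables is equivalent to a valid or to an
    inconsistent formula, whatever it says about the model. *)
Lemma def_prop (Q : Prop) : definable (fun _ => Q).
Proof.
  destruct (ZF_model_inhabited M) as [m].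
  destruct (classic Q) as [q|q].
  - exists (FEq 0 0), (fun _ => m); simpl; tauto.
  - exists (FNot (FEq 0 0)), (fun _ => m); simpl; tauto.
Qed.

Lemma deff_var k : definable_fun (fun e => e k).
Proof.
  destruct (ZF_model_inhabited M) as [m].
  exists (FEq (code (inl 0)) (code (inl (S k)))), (fun _ => m); intros e.
  cbn [sat]; now rewrite !merge_code.
Qed.

Lemma deff_const (a : M) : definable_fun (fun _ => a).
Proof.
  exists (FEq (code (inl 0)) (code (inr 0))), (fun _ => a); intros e.
  cbn [sat]; now rewrite !merge_code.
Qed.

(** The language has no terms, so the value of [F] is introduced by an existential quantifier and
    its graph. *)
Lemma def_subst (F : (nat -> M) -> M) (P : M -> (nat -> M) -> Prop) :
  definable_fun F -> definable (fun e => P (e 0) (fun n => e (S n))) ->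
  definable (fun e => P (F e) e).
Proof.
  intros HF HP; apply def_ext with (fun e => exists x, x = F e /\ P x e).
  - intros e; split; [intros H; now exists (F e)|now intros (x & -> & H)].
  - now apply (def_ex (P := fun x e => x = F e /\ P x e)), def_and.
Qed.

Lemma deff_weak F : definable_fun F -> definable_fun (fun e => F (fun n => e (S n))).
Proof. exact (def_rename (lift S) (P := fun e => e 0 = F (fun n => e (S n)))). Qed.

Definition def1 (P : M -> Prop) := definable (fun e => P (e 0)).
Definition def2 (P : M -> M -> Prop) := definable (fun e => P (e 0) (e 1)).
Definition def3 (P : M -> M -> M -> Prop) :=
  definable (fun e => P (e 0) (e 1) (e 2)).
Definition def4 (P : M -> M -> M -> M -> Prop) :=
  definable (fun e => P (e 0) (e 1) (e 2) (e 3)).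

Lemma def_app1 (P : M -> Prop) F :
  def1 P -> definable_fun F -> definable (fun e => P (F e)).
Proof.
  intros HP HF; apply (def_subst (P := fun x _ => P x) HF); exact HP.
Qed.

Lemma def_app2 (P : M -> M -> Prop) F G :
  def2 P -> definable_fun F -> definable_fun G ->
  definable (fun e => P (F e) (G e)).
Proof.
  intros HP HF HG; apply (def_subst (P := fun x e => P x (G e)) HF).
  apply (def_subst (P := fun y e => P (e 0) y) (deff_weak HG)).
  (* Each substitution pushes its value at index 0, so the arguments end up in reverse order. *)
  exact (def_rename (fun n => 1 - n) HP).
Qed.

Lemma def_app3 (P : M -> M -> M -> Prop) F G H :
  def3 P -> definable_fun F -> definable_fun G -> definable_fun H ->
  definable (fun e => P (F e) (G e) (H e)).
Proof.
  intros HP HF HG HH; apply (def_subst (P := fun x e => P x (G e) (H e)) HF).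
  apply (def_subst (P := fun y e => P (e 0) y (H (fun n => e (S n)))) (deff_weak HG)).
  apply (def_subst (P := fun z e => P (e 1) (e 0) z) (deff_weak (deff_weak HH))).
  exact (def_rename (fun n => 2 - n) HP).
Qed.

Lemma def_app4 (P : M -> M -> M -> M -> Prop) F G H K :
  def4 P -> definable_fun F -> definable_fun G -> definable_fun H ->
  definable_fun K -> definable (fun e => P (F e) (G e) (H e) (K e)).
Proof.
  intros HP HF HG HH HK.
  apply (def_subst (P := fun x e => P x (G e) (H e) (K e)) HF).
  apply (def_subst (P := fun y e => P (e 0) y (H (fun n => e (S n)))
    (K (fun n => e (S n)))) (deff_weak HG)).
  apply (def_subst (P := fun z e => P (e 1) (e 0) z (K (fun n => e (S (S n)))))
    (deff_weak (deff_weak HH))).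
  apply (def_subst (P := fun u e => P (e 2) (e 1) (e 0) u)
    (deff_weak (deff_weak (deff_weak HK)))).
  exact (def_rename (fun n => 3 - n) HP).
Qed.

Lemma def_mem F G :
  definable_fun F -> definable_fun G -> definable (fun e => F e ∈ G e).
Proof.
  apply def_app2; destruct (ZF_model_inhabited M) as [m].
  exists (FMem (code (inl 0)) (code (inl 1))), (fun _ => m); intros e.
  cbn [sat]; now rewrite !merge_code.
Qed.

Lemma def_eq F G :
  definable_fun F -> definable_fun G -> definable (fun e => F e = G e).
Proof.
  apply def_app2; destruct (ZF_model_inhabited M) as [m].
  exists (FEq (code (inl 0)) (code (inl 1))), (fun _ => m); intros e.
  cbn [sat]; now rewrite !merge_code.
Qed.

Lemma compr_spec (P : M -> Prop) :
  (exists a, forall x, x ∈ a <-> P x) -> forall x, x ∈ compr P <-> P x.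
Proof. intros H; unfold compr, iota; exact (epsilon_spec _ _ H). Qed.

(** The comprehension must exist for every environment: elsewhere [compr] is an arbitrary value of
    [epsilon], while for a set extensionality turns the graph into a first-order condition. *)
Lemma deff_compr (P : M -> (nat -> M) -> Prop) :
  (forall e, exists a, forall x, x ∈ a <-> P x e) ->
  definable (fun e => P (e 0) (fun n => e (S n))) ->
  definable_fun (fun e => compr (fun x => P x e)).
Proof.
  intros Hex HP; unfold definable_fun.
  apply def_ext with (fun e => forall x, x ∈ e 0 <-> P x (fun n => e (S n))).
  - intros e; split.
    + intros -> ; apply (compr_spec (Hex (fun n => e (S n)))).
    + intros H; apply zf_extensionality; intros x.
      rewrite (compr_spec (Hex (fun n => e (S n)))); apply H.
  - apply def_all, def_iff.
    + apply def_mem; apply deff_var.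
    + exact (def_rename (fun n => match n with 0 => 0 | S k => S (S k) end) HP).
Qed.

Lemma sep (P : M -> Prop) a :
  def1 P -> exists b, forall x, x ∈ b <-> x ∈ a /\ P x.
Proof.
  intros (phi & c & H).
  (* Every variable index is sent to 0, the candidate element, and parameter [k] to index [S k],
     which is the layout the axiom expects. *)
  destruct (zf_separation (rename
    (fun n => match decode n with inl _ => 0 | inr k => S k end) phi) c a) as [b Hb].
  exists b; intros x; rewrite Hb, sat_rename, (H (fun _ => x)).
  erewrite sat_ext; [reflexivity|]; intros n; unfold merge.
  now destruct (decode n).
Qed.

End Definability.

Create HintDb defn.

Ltac defn_unfold :=
  progress unfold subset, nonempty, unique, def1, def2, def3, def4, inductive_set.

(** Extension point, redefined once the basic set operations are known to be definable. *)
Ltac defn_hook := fail.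

Ltac defn :=
  cbv beta;
  lazymatch goal with
  | |- definable (fun _ => ?Q) => exact (@def_prop _ Q)
  | |- definable (fun e => @?P e /\ @?Q e) => apply (def_and (P := P) (Q := Q)); defn
  | |- definable (fun e => @?P e \/ @?Q e) => apply (def_or (P := P) (Q := Q)); defn
  | |- definable (fun e => @?P e <-> @?Q e) => apply (def_iff (P := P) (Q := Q)); defn
  | |- definable (fun e => ~ @?P e) => apply (def_not (P := P)); defn
  | |- definable (fun e => @?F e ∈ @?G e) => apply (def_mem (F := F) (G := G)); defn
  | |- definable (fun e => @?F e = @?G e) => apply (def_eq (F := F) (G := G)); defn
  | |- definable (fun e => ex _) => apply def_ex; defn
  | |- definable_fun (fun _ => ?a) => exact (@deff_const _ a)
  | |- definable_fun (fun e => e ?k) => exact (@deff_var _ k)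
  | |- definable_fun _ => first [solve [eauto with defn nocore] | defn_hook]
  | |- definable _ => first
     [ match goal with
       | |- definable (fun e => @?P e -> @?Q e) => apply (def_imp (P := P) (Q := Q))
       | |- definable (fun e => forall x, _) => apply def_all
       end; defn
     | match goal with
       | |- definable (fun e => ?P (@?F e)) =>
           apply (def_app1 (P := P) (F := F)); [solve [eauto with defn nocore]|..]
       | |- definable (fun e => ?P (@?F e) (@?G e)) =>
           apply (def_app2 (P := P) (F := F) (G := G));
             [solve [eauto with defn nocore]|..]
       | |- definable (fun e => ?P (@?F e) (@?G e) (@?H e)) =>
           apply (def_app3 (P := P) (F := F) (G := G) (H := H));
             [solve [eauto with defn nocore]|..]
       | |- definable (fun e => ?P (@?F e) (@?G e) (@?H e) (@?K e)) =>
           apply (def_app4 (P := P) (F := F) (G := G) (H := H) (K := K));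
             [solve [eauto with defn nocore]|..]
       end; defn
     | defn_hook
     | defn_unfold; defn ]
  | |- _ => defn_unfold; defn
  end.

(** * Elementary set theory in the model *)

Section Sets.
Variable M : ZF_model.
Implicit Types a b f x y z n m X T d p q : M.

Lemma empty_spec x : ~ x ∈ empty M.
Proof.
  assert (H : exists a : M, forall x, x ∈ a <-> False).
  { destruct (ZF_model_inhabited M) as [w].
    destruct (sep (P := fun _ => False) w) as [b Hb]; [defn|].
    exists b; intros y; rewrite Hb; tauto. }
  exact (proj1 (compr_spec H x)).
Qed.

Lemma set_ext a b : (forall x, x ∈ a <-> x ∈ b) -> a = b.
Proof. apply zf_extensionality. Qed.

Lemma upair_spec a b x : x ∈ upair a b <-> x = a \/ x = b.
Proof. exact (compr_spec (zf_pairing a b) x). Qed.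

Lemma deff_upair F G : definable_fun F -> definable_fun G ->
  definable_fun (fun e => upair (F e) (G e) : M).
Proof.
  intros HF HG; apply deff_compr; [intros e; apply zf_pairing|].
  pose proof (deff_weak HF); pose proof (deff_weak HG).
  apply def_or; apply def_eq; auto; apply deff_var.
Qed.

Lemma deff_opair F G : definable_fun F -> definable_fun G ->
  definable_fun (fun e => opair (F e) (G e) : M).
Proof. intros; unfold opair; repeat apply deff_upair; assumption. Qed.

Lemma opair_inj a b x y : opair a b = opair x y -> a = x /\ b = y.
Proof.
  intros H.
  assert (K : forall z, z ∈ opair a b <-> z ∈ opair x y) by (now rewrite H).
  unfold opair in K.
  assert (E : forall u v w : M, upair u v = upair w w -> u = w /\ v = w).
  { intros u v w E; split.
    - assert (H' : u ∈ upair w w) by (rewrite <- E; apply upair_spec; auto).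
      apply upair_spec in H'; tauto.
    - assert (H' : v ∈ upair w w) by (rewrite <- E; apply upair_spec; auto).
      apply upair_spec in H'; tauto. }
  assert (ax : a = x).
  { destruct (proj1 (upair_spec _ _ _) (proj1 (K (upair a a))
      (proj2 (upair_spec _ _ _) (or_introl eq_refl)))) as [e|e].
    - now apply E in e.
    - symmetry in e; apply E in e; symmetry; tauto. }
  subst x; split; [reflexivity|].
  assert (K1 := proj1 (upair_spec _ _ _) (proj1 (K (upair a b))
      (proj2 (upair_spec _ _ _) (or_intror eq_refl)))).
  assert (K2 := proj1 (upair_spec _ _ _) (proj2 (K (upair a y))
      (proj2 (upair_spec _ _ _) (or_intror eq_refl)))).
  destruct K1 as [e|e].
  - apply E in e; destruct e as [_ e]; subst b.
    destruct K2 as [e|e]; apply E in e; symmetry; tauto.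
  - assert (Hb : b ∈ upair a y) by (rewrite <- e; apply upair_spec; auto).
    assert (Hy : y ∈ upair a b) by (rewrite e; apply upair_spec; auto).
    apply upair_spec in Hb; apply upair_spec in Hy.
    destruct Hb as [->|]; [|assumption]; destruct Hy; auto.
Qed.

Lemma bigunion_spec a x : x ∈ bigunion a <-> exists y, y ∈ a /\ x ∈ y.
Proof. exact (compr_spec (zf_union a) x). Qed.

Lemma power_spec a x : x ∈ power a <-> subset x a.
Proof. exact (compr_spec (zf_power a) x). Qed.

Lemma compr_sep (P : M -> Prop) a :
  def1 P -> (forall x, P x -> x ∈ a) -> forall x, x ∈ compr P <-> P x.
Proof.
  intros HP Ha; apply compr_spec; destruct (sep a HP) as [b Hb].
  exists b; intros x; rewrite Hb; firstorder.
Qed.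

Lemma inter_ex a b : exists c, forall x, x ∈ c <-> x ∈ a /\ x ∈ b.
Proof. apply sep; defn. Qed.

Lemma inter_spec a b x : x ∈ inter a b <-> x ∈ a /\ x ∈ b.
Proof. exact (compr_spec (inter_ex a b) x). Qed.

Lemma diff_ex a b : exists c, forall x, x ∈ c <-> x ∈ a /\ ~ x ∈ b.
Proof. apply (sep (P := fun x => ~ x ∈ b)); defn. Qed.

Lemma diff_spec a b x : x ∈ diff a b <-> x ∈ a /\ ~ x ∈ b.
Proof. exact (compr_spec (diff_ex a b) x). Qed.

Lemma succ_ex n : exists a, forall x, x ∈ a <-> x ∈ n \/ x = n.
Proof.
  exists (bigunion (upair n (upair n n))); intros x; rewrite bigunion_spec; split.
  - intros (y & Hy & Hx); apply upair_spec in Hy as [->| ->]; auto.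
    apply upair_spec in Hx; tauto.
  - intros [H| ->]; [exists n|exists (upair n n)]; rewrite ?upair_spec; auto.
Qed.

Lemma succ_spec n x : x ∈ succ n <-> x ∈ n \/ x = n.
Proof. exact (compr_spec (succ_ex n) x). Qed.

Lemma deff_succ F : definable_fun F -> definable_fun (fun e => succ (F e) : M).
Proof.
  intros HF; apply deff_compr; [intros e; apply succ_ex|].
  pose proof (deff_weak HF).
  apply def_or; [apply def_mem|apply def_eq]; auto; apply deff_var.
Qed.

Lemma deff_diff F G : definable_fun F -> definable_fun G ->
  definable_fun (fun e => diff (F e) (G e) : M).
Proof.
  intros HF HG; apply deff_compr; [intros e; apply diff_ex|].
  pose proof (deff_weak HF); pose proof (deff_weak HG).
  apply def_and; [|apply def_not]; apply def_mem; auto; apply deff_var.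
Qed.

Lemma deff_inter F G : definable_fun F -> definable_fun G ->
  definable_fun (fun e => inter (F e) (G e) : M).
Proof.
  intros HF HG; apply deff_compr; [intros e; apply inter_ex|].
  pose proof (deff_weak HF); pose proof (deff_weak HG).
  apply def_and; apply def_mem; auto; apply deff_var.
Qed.

Lemma deff_bigunion F : definable_fun F ->
  definable_fun (fun e => bigunion (F e) : M).
Proof.
  intros HF; apply deff_compr; [intros e; apply zf_union|].
  apply def_ex, def_and; apply def_mem; try apply deff_var.
  exact (deff_weak (deff_weak HF)).
Qed.

End Sets.

Ltac defn_hook ::=
  first [apply deff_opair | apply deff_succ | apply deff_diff | apply deff_inter
        | apply deff_bigunion]; defn.

(** * Products and the natural numbers of the model *)

Section Naturals.
Variable M : ZF_model.
Implicit Types a b f x y z n m X T d p q : M.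

Lemma prod_ex a b : exists c, forall p,
  p ∈ c <-> exists x y, x ∈ a /\ y ∈ b /\ p = opair x y.
Proof.
  destruct (sep (P := fun p => exists x y, x ∈ a /\ y ∈ b /\ p = opair x y)
    (power (power (bigunion (upair a b))))) as [c Hc]; [defn|].
  exists c; intros p; rewrite Hc; split; [tauto|]; intros H; split; [|exact H].
  destruct H as (x & y & Hx & Hy & ->); apply power_spec; intros u Hu.
  apply power_spec; intros v Hv; apply bigunion_spec.
  apply upair_spec in Hu as [->| ->]; apply upair_spec in Hv as [->| ->];
    [exists a|exists a|exists a|exists b]; rewrite upair_spec; auto.
Qed.

Lemma prod_spec a b p :
  p ∈ prod a b <-> exists x y, x ∈ a /\ y ∈ b /\ p = opair x y.
Proof. exact (compr_spec (prod_ex a b) p). Qed.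

Lemma prod_opair a b x y : opair x y ∈ prod a b <-> x ∈ a /\ y ∈ b.
Proof.
  rewrite prod_spec; split; [|intros []; now exists x, y].
  intros (u & v & Hu & Hv & E); apply opair_inj in E as [-> ->]; auto.
Qed.

Lemma sep2 (P : M -> M -> Prop) a b : def2 P ->
  exists r, forall x y, opair x y ∈ r <-> x ∈ a /\ y ∈ b /\ P x y.
Proof.
  intros HP.
  destruct (sep (P := fun p => exists x y, p = opair x y /\ P x y) (prod a b))
    as [r Hr]; [defn|].
  exists r; intros x y; rewrite Hr, prod_opair; split.
  - intros ((Hx & Hy) & u & v & E & H); apply opair_inj in E as [-> ->]; auto.
  - intros (? & ? & ?); repeat split; auto; now exists x, y.
Qed.

Lemma sep2_sub (P : M -> M -> Prop) a b : def2 P ->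
  exists r, subset r (prod a b) /\
    forall x y, opair x y ∈ r <-> x ∈ a /\ y ∈ b /\ P x y.
Proof.
  intros HP; destruct (sep2 a b HP) as [r Hr].
  exists (inter r (prod a b)); split.
  - intros p Hp; now apply inter_spec in Hp.
  - intros x y; rewrite inter_spec, prod_opair, Hr; tauto.
Qed.

Lemma inductive_ex : exists w : M, inductive_set w.
Proof.
  destruct (zf_infinity M) as (w & (z & Hz & Hz') & Hs); exists w; split.
  - replace (empty M) with z; auto; apply set_ext; intros x.
    split; intros H; [now apply Hz' in H|now apply empty_spec in H].
  - intros n Hn; destruct (Hs n Hn) as (y & Hy & H).
    replace (succ n) with y; auto; apply set_ext; intros x.
    now rewrite H, succ_spec.
Qed.

Lemma omega_spec n : n ∈ omega M <-> forall a, inductive_set a -> n ∈ a.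
Proof.
  destruct inductive_ex as [w Hw]; apply (@compr_sep _ (fun n => forall a, inductive_set a -> n ∈ a) w); [|auto].
  unfold inductive_set; defn.
Qed.

Lemma omega0 : empty M ∈ omega M.
Proof. apply omega_spec; now intros a []. Qed.

Lemma omegaS n : n ∈ omega M -> succ n ∈ omega M.
Proof.
  rewrite !omega_spec; intros H a Ha; apply Ha, H, Ha.
Qed.

Lemma omega_ind (P : M -> Prop) : def1 P -> P (empty M) ->
  (forall n, n ∈ omega M -> P n -> P (succ n)) ->
  forall n, n ∈ omega M -> P n.
Proof.
  intros HP H0 HS n Hn; destruct (sep (omega M) HP) as [a Ha].
  apply (Ha n), (proj1 (omega_spec n) Hn); split.
  - apply Ha; split; auto using omega0.
  - intros m Hm; apply Ha in Hm as []; apply Ha; auto using omegaS.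
Qed.

End Naturals.

Ltac omega_elim :=
  lazymatch goal with
  | |- forall n, n ∈ omega _ -> @?P n =>
      refine (omega_ind (P := P) _ _ _); cbv beta; [defn| |]
  end.

(** * The order on omega *)

Section NaturalOrder.
Variable M : ZF_model.
Implicit Types a b f x y z n m X T d p q : M.

Lemma mem_irrefl x : ~ x ∈ x.
Proof.
  intros H; destruct (zf_foundation (a := upair x x)) as (y & Hy & Hm).
  - exists x; apply upair_spec; auto.
  - apply upair_spec in Hy as [->| ->]; apply (Hm x H), upair_spec; auto.
Qed.

Lemma omega_trans n : n ∈ omega M -> forall m k, m ∈ n -> k ∈ m -> k ∈ n.
Proof.
  revert n; omega_elim.
  - intros m k H; now apply empty_spec in H.
  - intros n _ IH m k; rewrite !succ_spec; intros [H| ->] Hk; left; eauto.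
Qed.

Lemma omega_sub n m : n ∈ omega M -> m ∈ n -> m ∈ omega M.
Proof.
  intros Hn; revert n Hn m; omega_elim.
  - intros m H; now apply empty_spec in H.
  - intros n Hn IH m; rewrite succ_spec; intros [H| ->]; auto.
Qed.

Lemma omega0_or n : n ∈ omega M -> n = empty M \/ empty M ∈ n.
Proof.
  revert n; omega_elim; [auto|].
  intros n _ [->|H]; right; apply succ_spec; auto.
Qed.

Lemma omegaS_mem n : n ∈ omega M -> forall m, m ∈ n -> succ m ∈ succ n.
Proof.
  revert n; omega_elim.
  - intros m H; now apply empty_spec in H.
  - intros n Hn IH m; rewrite succ_spec; intros [H| ->]; apply succ_spec; auto.
Qed.

Lemma omega_total n : n ∈ omega M -> forall m, m ∈ omega M ->
  n ∈ m \/ n = m \/ m ∈ n.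
Proof.
  revert n; omega_elim.
  - intros m Hm; destruct (omega0_or Hm); auto.
  - intros n Hn IH m Hm; destruct (IH m Hm) as [H|[->|H]].
    + destruct (proj1 (succ_spec _ _) (omegaS_mem Hm H)); auto.
    + right; right; apply succ_spec; auto.
    + right; right; apply succ_spec; auto.
Qed.

Lemma succ_inj n m : n ∈ omega M -> m ∈ omega M -> succ n = succ m -> n = m.
Proof.
  intros Hn Hm E.
  assert (H : n ∈ succ m) by (rewrite <- E; apply succ_spec; auto).
  assert (H' : m ∈ succ n) by (rewrite E; apply succ_spec; auto).
  apply succ_spec in H as [H|]; auto; apply succ_spec in H' as [H'|]; auto.
  destruct (mem_irrefl (omega_trans Hn H' H)).
Qed.

Lemma succ_neq0 n : succ n <> empty M.
Proof.
  intros E; apply (empty_spec (M := M) (x := n)); rewrite <- E, succ_spec; auto.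
Qed.

Lemma omega_case n : n ∈ omega M ->
  n = empty M \/ exists m, m ∈ omega M /\ n = succ m.
Proof.
  revert n; omega_elim; [auto|]; intros n Hn _; right; eauto.
Qed.

(** Foundation provides a membership-minimal element, and membership is the order of [omega]. *)
Lemma omega_least (P : M -> Prop) : def1 P ->
  (exists n, n ∈ omega M /\ P n) ->
  exists n, n ∈ omega M /\ P n /\ forall m, m ∈ n -> ~ P m.
Proof.
  intros HP (n & Hn & HPn); destruct (sep (omega M) HP) as [a Ha].
  destruct (zf_foundation (a := a)) as (x & Hx & Hm).
  - exists n; now apply Ha.
  - apply Ha in Hx as []; exists x; repeat split; auto; intros m Hmx Hp.
    apply (Hm m Hmx), Ha; split; auto; eapply omega_sub; eauto.
Qed.

Lemma omega_max n m : n ∈ omega M -> m ∈ omega M ->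
  exists k, k ∈ omega M /\ (n = k \/ n ∈ k) /\ (m = k \/ m ∈ k).
Proof.
  intros Hn Hm; destruct (omega_total Hn Hm) as [H|[->|H]]; eauto 6.
Qed.

Lemma omega_mono (P : M -> Prop) : def1 P ->
  (forall n, n ∈ omega M -> P n -> P (succ n)) ->
  forall n m, m ∈ omega M -> n ∈ m -> P n -> P m.
Proof.
  intros HP HS n m Hm; revert m Hm; omega_elim.
  - intros H; now apply empty_spec in H.
  - intros m Hm IH; rewrite succ_spec; intros [H| ->]; auto.
Qed.

Lemma omega_strong_ind (P : M -> Prop) : def1 P ->
  (forall n, n ∈ omega M -> (forall m, m ∈ n -> P m) -> P n) ->
  forall n, n ∈ omega M -> P n.
Proof.
  intros HP H n Hn; apply NNPP; intros Hc.
  destruct (@omega_least (fun n => ~ P n)) as (k & Hk & Hk' & Hl); [defn|eauto|].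
  apply Hk', H; auto; intros m Hm; apply NNPP; now apply Hl.
Qed.

End NaturalOrder.

(** * Functions as sets of pairs, and countability *)

Section Functions.
Variable M : ZF_model.
Implicit Types a b f x y z n m X T d p q : M.

Lemma fun_dom f a b x y : is_fun f a b -> opair x y ∈ f -> x ∈ a /\ y ∈ b.
Proof. intros [Hs _] H; apply prod_opair, Hs, H. Qed.

Lemma app_opair f a b x : is_fun f a b -> x ∈ a -> opair x (app f x) ∈ f.
Proof.
  intros [_ H] Hx; destruct (H x Hx) as (y & Hy & _).
  unfold app, iota; apply (epsilon_spec _ (fun y => opair x y ∈ f)); eauto.
Qed.

Lemma fun_unique f a b x y y' : is_fun f a b ->
  opair x y ∈ f -> opair x y' ∈ f -> y = y'.
Proof.
  intros Hf H H'; destruct (fun_dom Hf H) as [Hx _].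
  destruct Hf as [_ Hu]; destruct (Hu x Hx) as (z & _ & Hz).
  now rewrite <- (Hz y H), <- (Hz y' H').
Qed.

Lemma app_eq f a b x y : is_fun f a b -> opair x y ∈ f -> app f x = y.
Proof.
  intros Hf H; destruct (fun_dom Hf H) as [Hx _].
  exact (fun_unique Hf (app_opair Hf Hx) H).
Qed.

Lemma app_in f a b x : is_fun f a b -> x ∈ a -> app f x ∈ b.
Proof. intros Hf Hx; exact (proj2 (fun_dom Hf (app_opair Hf Hx))). Qed.

Lemma fun_ex (P : M -> M -> Prop) a b : def2 P ->
  (forall x, x ∈ a -> exists y, y ∈ b /\ P x y) ->
  (forall x y y', x ∈ a -> y ∈ b -> y' ∈ b -> P x y -> P x y' -> y = y') ->
  exists f, is_fun f a b /\
    forall x y, opair x y ∈ f <-> x ∈ a /\ y ∈ b /\ P x y.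
Proof.
  intros HP Hex Hun; destruct (sep2_sub a b HP) as (f & Hs & Hf).
  exists f; split; [split; [exact Hs|]|exact Hf].
  intros x Hx; destruct (Hex x Hx) as (y & Hy & HPy); exists y; split.
  - now apply Hf.
  - intros y' H'; apply Hf in H'; destruct H' as (_ & ? & ?); eauto.
Qed.

(** The least index of each element gives an injection into [omega], so a partial surjection with
    repetitions suffices and nothing is chosen. *)
Lemma countable_image (P : M -> M -> Prop) a : def2 P ->
  (forall n z z', n ∈ omega M -> P n z -> P n z' -> z = z') ->
  (forall z, z ∈ a -> exists n, n ∈ omega M /\ P n z) -> countable a.
Proof.
  intros HP Hun Hex.
  set (Q := fun z n => P n z /\ forall m, m ∈ n -> ~ P m z).
  assert (HQ : def2 Q) by (unfold Q; defn).
  assert (Hle : forall z n n', n ∈ omega M -> n' ∈ omega M ->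
    Q z n -> Q z n' -> n = n').
  { intros z n n' Hn Hn' [H1 H2] [H1' H2'].
    destruct (omega_total Hn Hn') as [h|[h|h]]; [|exact h|].
    - now destruct (H2' _ h).
    - now destruct (H2 _ h). }
  destruct (sep (P := fun n => exists z, z ∈ a /\ Q z n) (omega M)) as [b Hb];
    [defn|].
  exists b; split; [intros n Hn; now apply Hb in Hn|].
  destruct (@fun_ex Q a b) as (f & Hf & Hf'); [exact HQ| | |].
  - intros z Hz; destruct (@omega_least M (fun n => P n z)) as (n & Hn & H1 & H2);
      [defn|auto|].
    assert (Q z n) by (split; auto).
    exists n; split; [apply Hb|]; eauto.
  - intros z n n' _ Hn Hn'; apply Hb in Hn as []; apply Hb in Hn' as []; eauto.
  - exists f; split; [exact Hf|]; intros n Hn; assert (Hn' := Hn).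
    apply Hb in Hn' as (Ho & z & Hz & H); exists z; split.
    + now apply Hf'.
    + intros z' H'; apply Hf' in H' as (_ & _ & H'); unfold Q in *.
      apply (Hun n); tauto.
Qed.

(** The enumeration is a partial function, which treats empty, finite and infinite sets alike
    without a default value. *)
Lemma countable_enum a : countable a -> exists f,
  (forall n z z', opair n z ∈ f -> opair n z' ∈ f -> z = z') /\
  (forall n z, opair n z ∈ f -> n ∈ omega M /\ z ∈ a) /\
  (forall z, z ∈ a -> exists n, n ∈ omega M /\ opair n z ∈ f).
Proof.
  intros (b & Hb & g & Hg & Hs).
  destruct (@sep2 M (fun n z => opair z n ∈ g) b a) as [f Hf]; [defn|].
  exists f; repeat split.
  - intros n z z' H H'; apply Hf in H as (Hn & Hz & H).
    apply Hf in H' as (_ & _ & H'); destruct (Hs n Hn) as (w & _ & Hw).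
    now rewrite <- (Hw z H), <- (Hw z' H').
  - apply Hf in H as (H & _); auto.
  - apply Hf in H; tauto.
  - intros z Hz; exists (app g z).
    pose proof (app_opair Hg Hz); pose proof (app_in Hg Hz).
    split; [auto|]; now apply Hf.
Qed.

End Functions.

(** * Recursion on omega *)

Section Recursion.
Variable M : ZF_model.
Implicit Types a b c f x y z n m X T d p q : M.

(* The graph of the sequence of elements of [A] with first term [a0] and
   [G n (u n) (u (n + 1))] for all [n]; it is a class relation, so that it can
   be used inside definable predicates with varying parameters. *)
Definition recrel (A a0 : M) (G : M -> M -> M -> Prop) n a : Prop :=
  n ∈ omega M /\ a ∈ A /\
  forall S, opair (empty M) a0 ∈ S ->
    (forall k b c, k ∈ omega M -> b ∈ A -> c ∈ A -> opair k b ∈ S -> G k b c ->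
       opair (succ k) c ∈ S) ->
    opair n a ∈ S.

Variables (A a0 : M) (G : M -> M -> M -> Prop).
Hypothesis a0A : a0 ∈ A.
Hypothesis Gdef : def3 G.
Hypothesis Gtotal : forall n a, n ∈ omega M -> a ∈ A -> exists b, b ∈ A /\ G n a b.
Hypothesis Gfun : forall n a b b', n ∈ omega M -> a ∈ A -> b ∈ A -> b' ∈ A ->
  G n a b -> G n a b' -> b = b'.

Local Notation R := (recrel A a0 G).

Lemma recrel_def : def2 R.
Proof using Gdef. unfold recrel; defn. Qed.
Local Hint Resolve recrel_def Gdef : defn.

Lemma recrel0 : R (empty M) a0.
Proof using a0A. repeat split; auto using omega0. Qed.

Lemma recrelS n a b : R n a -> b ∈ A -> G n a b -> R (succ n) b.
Proof using.
  intros (Hn & Ha & H) Hb HG; repeat split; auto using omegaS.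
  intros S H0 HS; eauto.
Qed.

Lemma recrel_ind (P : M -> M -> Prop) : def2 P -> P (empty M) a0 ->
  (forall n a b, R n a -> P n a -> b ∈ A -> G n a b -> P (succ n) b) ->
  forall n a, R n a -> P n a.
Proof using Gdef a0A.
  intros HP H0 HS n a (Hn & Ha & H).
  destruct (@sep2 M (fun n a => R n a /\ P n a) (omega M) A) as [S HSs]; [defn|].
  assert (HS' : opair n a ∈ S); [apply H|apply HSs in HS'; tauto].
  - apply HSs; auto using omega0, recrel0.
  - intros k b c Hk Hb Hc HSk HG; apply HSs in HSk as (_ & _ & HR & HPk).
    apply HSs; pose proof (recrelS HR Hc HG); eauto 6 using omegaS.
Qed.

Lemma recrel_total n : n ∈ omega M -> exists a, R n a.
Proof using Gdef Gtotal a0A.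
  revert n; omega_elim.
  - exists a0; apply recrel0.
  - intros n Hn (a & Ha); destruct (Gtotal Hn (proj1 (proj2 Ha))) as (b & Hb & HG).
    exists b; exact (recrelS Ha Hb HG).
Qed.

(** [recrel] is an intersection of closed families, so it says what is generated; uniqueness needs
    the converse, that each term arises from a previous one. *)
Lemma recrel_inv n a : R n a ->
  (n = empty M -> a = a0) /\
  (forall m, m ∈ omega M -> n = succ m -> exists b, R m b /\ G m b a).
Proof using Gdef a0A.
  revert n a; apply (@recrel_ind (fun n a => (n = empty M -> a = a0) /\
    (forall m, m ∈ omega M -> n = succ m -> exists b, R m b /\ G m b a))).
  - defn.
  - split; auto; intros m _ E; symmetry in E; now apply succ_neq0 in E.
  - intros n a b HR _ Hb HG; split; [intros E; now apply succ_neq0 in E|].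
    intros m Hm E; apply succ_inj in E; auto; [subst m; eauto|apply HR].
Qed.

Lemma recrel_unique n a b : R n a -> R n b -> a = b.
Proof using Gdef Gfun a0A.
  intros Ha; revert b; assert (Hn : n ∈ omega M) by apply Ha.
  revert n Hn a Ha; omega_elim.
  - intros a Ha b Hb; apply recrel_inv in Ha as [-> _]; auto.
    apply recrel_inv in Hb as [-> _]; auto.
  - intros n Hn IH a Ha b Hb.
    destruct (proj2 (recrel_inv Ha) n Hn eq_refl) as (a' & Ha' & HG).
    destruct (proj2 (recrel_inv Hb) n Hn eq_refl) as (b' & Hb' & HG').
    rewrite (IH b' Hb' a' Ha') in HG'.
    apply (Gfun Hn (proj1 (proj2 Ha')) (proj1 (proj2 Ha)) (proj1 (proj2 Hb)) HG HG').
Qed.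

Lemma recrel_next n a b : R n a -> R (succ n) b -> G n a b.
Proof using Gdef Gfun a0A.
  intros Ha Hb; destruct (proj2 (recrel_inv Hb) n (proj1 Ha) eq_refl) as (a' & Ha' & HG).
  now rewrite (recrel_unique Ha Ha').
Qed.

End Recursion.

(** * Enumerating pairs of natural numbers *)

Section Pairs.
Variable M : ZF_model.
Implicit Types a b c f x y z n m i j N X T d p q s : M.

(* Runs through all triples ((N, i), j) with i, j <= N in lexicographic order. *)
Definition next_triple (k s s' : M) : Prop :=
  exists N i j, N ∈ omega M /\ i ∈ omega M /\ j ∈ omega M /\
    s = opair (opair N i) j /\
    ((j ∈ N /\ s' = opair (opair N i) (succ j)) \/
     (~ j ∈ N /\ i ∈ N /\ s' = opair (opair N (succ i)) (empty M)) \/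
     (~ j ∈ N /\ ~ i ∈ N /\ s' = opair (opair (succ N) (empty M)) (empty M))).

Definition triples : M := prod (prod (omega M) (omega M)) (omega M).
Definition triple (n s : M) : Prop :=
  recrel triples (opair (opair (empty M) (empty M)) (empty M)) next_triple n s.

Lemma next_triple_def : def3 next_triple.
Proof. unfold next_triple; defn. Qed.

Lemma triple_def : def2 triple.
Proof. apply recrel_def, next_triple_def. Qed.

Lemma triples_in N i j : N ∈ omega M -> i ∈ omega M -> j ∈ omega M ->
  opair (opair N i) j ∈ triples.
Proof. intros; unfold triples; now rewrite !prod_opair. Qed.

Lemma next_triple_fun n s t t' : next_triple n s t -> next_triple n s t' -> t = t'.
Proof.
  intros (N & i & j & _ & _ & _ & -> & H) (N' & i' & j' & _ & _ & _ & E & H').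
  apply opair_inj in E as [E <-]; apply opair_inj in E as [<- <-].
  destruct H as [[? ->]|[(? & ? & ->)|(? & ? & ->)]];
    destruct H' as [[? ->]|[(? & ? & ->)|(? & ? & ->)]]; tauto.
Qed.

Lemma triple_fun n s s' : triple n s -> triple n s' -> s = s'.
Proof.
  apply recrel_unique.
  - apply triples_in; apply omega0.
  - apply next_triple_def.
  - intros; eapply next_triple_fun; eauto.
Qed.

(** Nested inductions sweep a row, then the rows up to [N], then all [N]; any [N] above both
    coordinates reaches the pair. This gives pairing without arithmetic on [omega]. *)
Lemma triple_reach i j : i ∈ omega M -> j ∈ omega M ->
  exists n N, triple n (opair (opair N i) j).
Proof.
  pose proof triple_def as Ht.
  pose proof (omega0 M) as H0.
  set (reach := fun s => exists n, triple n s).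
  assert (Hr : def1 reach) by (unfold reach; defn).
  assert (step : forall s t, reach s -> next_triple (empty M) s t -> t ∈ triples -> reach t).
  { intros s t [n Hn] H Ht'; exists (succ n); exact (recrelS Hn Ht' H). }
  assert (rowj : forall N i, N ∈ omega M -> i ∈ omega M ->
    reach (opair (opair N i) (empty M)) -> forall j, j ∈ omega M ->
    (j ∈ N \/ j = N) -> reach (opair (opair N i) j)).
  { intros N i' HN Hi Hb; omega_elim; [auto|].
    intros k Hk IH Hle.
    assert (HkN : k ∈ N).
    { destruct Hle as [Hle|<-]; [|apply succ_spec; auto].
      apply (omega_trans HN Hle), succ_spec; auto. }
    apply (step (opair (opair N i') k)); [auto| |].
    - exists N, i', k; auto 8.
    - apply triples_in; auto using omegaS. }
  assert (rowi : forall N, N ∈ omega M ->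
    reach (opair (opair N (empty M)) (empty M)) -> forall i, i ∈ omega M ->
    (i ∈ N \/ i = N) -> reach (opair (opair N i) (empty M))).
  { intros N HN Hb; omega_elim; [auto|].
    intros k Hk IH Hle.
    assert (HkN : k ∈ N).
    { destruct Hle as [Hle|<-]; [|apply succ_spec; auto].
      apply (omega_trans HN Hle), succ_spec; auto. }
    apply (step (opair (opair N k) N)); [auto| |].
    - exists N, k, N; pose proof (mem_irrefl (x := N)); auto 12.
    - apply triples_in; auto using omegaS. }
  assert (all : forall N, N ∈ omega M -> reach (opair (opair N (empty M)) (empty M))).
  { omega_elim.
    - exists (empty M); apply recrel0; now apply triples_in.
    - intros N HN IH; apply (step (opair (opair N N) N)); [auto| |].
      + exists N, N, N; pose proof (mem_irrefl (x := N)); auto 12.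
      + apply triples_in; auto using omegaS. }
  intros Hi Hj; destruct (omega_max Hi Hj) as (N & HN & HiN & HjN).
  rewrite or_comm in HiN, HjN.
  destruct (rowj N i HN Hi (rowi N HN (all N HN) i Hi HiN) j Hj
    HjN) as [n Hn]; eauto.
Qed.

(** The enumeration of triples merges the two indices into one. A pair recurs for many [N], which is
    harmless for [countable_image]. *)
Lemma countable_image2 (P : M -> M -> M -> Prop) a : def3 P ->
  (forall i j z z', i ∈ omega M -> j ∈ omega M -> P i j z -> P i j z' -> z = z') ->
  (forall z, z ∈ a -> exists i j, i ∈ omega M /\ j ∈ omega M /\ P i j z) ->
  countable a.
Proof.
  intros HP Hun Hex; pose proof triple_def.
  apply (@countable_image M (fun n z => exists N i j, i ∈ omega M /\ j ∈ omega M /\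
    triple n (opair (opair N i) j) /\ P i j z)).
  - defn.
  - intros n z z' Hn (N & i & j & Hi & Hj & Ht & Hz) (N' & i' & j' & Hi' & Hj' & Ht' & Hz').
    assert (E := triple_fun Ht Ht').
    apply opair_inj in E as [E <-]; apply opair_inj in E as [<- <-]; eauto.
  - intros z Hz; destruct (Hex z Hz) as (i & j & Hi & Hj & H').
    destruct (triple_reach Hi Hj) as (n & N & Ht).
    exists n; split; [apply Ht|]; eauto 10.
Qed.

End Pairs.

(** * The real numbers of the model *)

Section RealArithmetic.
Variables (M : ZF_model) (K : field_data M).
Hypothesis hK : complete_ordered_field K.
Implicit Types a b c f x y z u v w n m d p q s : M.

Local Notation "0" := (Rzero K).
Local Notation "1" := (Rone K).
Local Notation "x + y" := (radd K x y).
Local Notation "x * y" := (rmul K x y).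
Local Notation "x <= y" := (rle K x y).
Local Notation "x < y" := (rlt K x y).
Local Notation R := (Rset K).

Let R0 := Rzero_in hK.
Let R1 := Rone_in hK.
Local Hint Resolve R0 R1 : core.

Lemma radd_in x y : x ∈ R -> y ∈ R -> x + y ∈ R.
Proof using hK.
  intros; apply (app_in (Radd_fun hK)), prod_opair; auto.
Qed.

Lemma rmul_in x y : x ∈ R -> y ∈ R -> x * y ∈ R.
Proof using hK.
  intros; apply (app_in (Rmul_fun hK)), prod_opair; auto.
Qed.
Local Hint Resolve radd_in rmul_in : core.

(** [app] is an [epsilon] term, arbitrary outside the domain. Definable predicates therefore mention
    sums through the graph, and this lemma translates. *)
Lemma radd_graph x y z : opair (opair x y) z ∈ Radd K <->
  x ∈ R /\ y ∈ R /\ z = x + y.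
Proof using hK.
  split.
  - intros H; destruct (fun_dom (Radd_fun hK) H) as [H' _].
    apply prod_opair in H' as []; repeat split; auto.
    symmetry; exact (app_eq (Radd_fun hK) H).
  - intros (Hx & Hy & ->); apply (app_opair (Radd_fun hK)); now apply prod_opair.
Qed.

Lemma rle_in x y : x <= y -> x ∈ R /\ y ∈ R.
Proof using hK. intros H; now apply prod_opair, (Rle_sub hK). Qed.

Lemma rlt_in x y : x < y -> x ∈ R /\ y ∈ R.
Proof using hK. intros [H _]; now apply rle_in. Qed.

Lemma rle_refl x : x ∈ R -> x <= x.
Proof using hK. intros H; destruct (Rle_total hK H H); auto. Qed.

Lemma rle_or_lt x y : x ∈ R -> y ∈ R -> x <= y \/ y < x.
Proof using hK.
  intros Hx Hy; destruct (classic (x = y)) as [->|E].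
  - left; now apply rle_refl.
  - destruct (Rle_total hK Hx Hy); auto; right; split; auto.
Qed.

Lemma rle_lt_trans x y z : x <= y -> y < z -> x < z.
Proof using hK.
  intros H [H' E]; split; [exact (Rle_trans hK H H')|].
  intros ->; apply E, (Rle_antisym hK); auto.
Qed.

Lemma rlt_le_trans x y z : x < y -> y <= z -> x < z.
Proof using hK.
  intros [H E] H'; split; [exact (Rle_trans hK H H')|].
  intros ->; apply E, (Rle_antisym hK); auto.
Qed.

Lemma rlt_not_le x y : x < y -> ~ y <= x.
Proof using hK. intros [H E] H'; apply E, (Rle_antisym hK); auto. Qed.

Lemma radd0l x : x ∈ R -> 0 + x = x.
Proof using hK. intros; rewrite (RaddC hK), (Radd0 hK); auto. Qed.

Lemma radd_cancel x y z : x ∈ R -> y ∈ R -> z ∈ R -> x + z = y + z -> x = y.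
Proof using hK.
  intros Hx Hy Hz E; destruct (RaddN hK Hz) as (t & Ht & Et).
  rewrite <- (Radd0 hK Hx), <- (Radd0 hK Hy), <- Et, !(RaddA hK) by auto.
  now rewrite E.
Qed.

Lemma rle_add_cancel x y z : x ∈ R -> y ∈ R -> z ∈ R -> x + z <= y + z -> x <= y.
Proof using hK.
  intros Hx Hy Hz E; destruct (RaddN hK Hz) as (t & Ht & Et).
  rewrite <- (Radd0 hK Hx), <- (Radd0 hK Hy), <- Et, !(RaddA hK) by auto.
  now apply (Rle_add hK).
Qed.

Lemma rlt_add_r x y z : z ∈ R -> x < y -> x + z < y + z.
Proof using hK.
  intros Hz [H E]; split; [now apply (Rle_add hK)|].
  destruct (rle_in H); intros E'; apply radd_cancel in E'; auto.
Qed.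

Lemma rle_add_l x y z : z ∈ R -> x <= y -> z + x <= z + y.
Proof using hK.
  intros Hz H; destruct (rle_in H); rewrite !(RaddC hK (x := z)); auto.
  now apply (Rle_add hK).
Qed.

Lemma rlt_add_l x y z : z ∈ R -> x < y -> z + x < z + y.
Proof using hK.
  intros Hz H; destruct (rlt_in H); rewrite !(RaddC hK (x := z)); auto.
  now apply rlt_add_r.
Qed.

Lemma rle_add2 x y z w : x <= y -> z <= w -> x + z <= y + w.
Proof using hK.
  intros H H'; destruct (rle_in H), (rle_in H').
  apply (Rle_trans hK) with (y + z); [now apply (Rle_add hK)|now apply rle_add_l].
Qed.

Lemma rlt_add2 x y z w : x < y -> z < w -> x + z < y + w.
Proof using hK.
  intros H H'; destruct (rlt_in H), (rlt_in H').
  apply rlt_le_trans with (y + z); [now apply rlt_add_r|].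
  apply rle_add_l; auto; apply H'.
Qed.

Lemma rlt_add_cancel x y z : x ∈ R -> y ∈ R -> z ∈ R -> x + z < y + z -> x < y.
Proof using hK.
  intros Hx Hy Hz [H E]; split; [now apply rle_add_cancel in H|].
  intros ->; now apply E.
Qed.

Lemma rle_addr x y : x ∈ R -> 0 <= y -> x <= x + y.
Proof using hK.
  intros Hx H; rewrite <- (Radd0 hK Hx) at 1; now apply rle_add_l.
Qed.

Lemma rlt_gap x y : x < y -> exists t, 0 < t /\ x + t = y.
Proof using hK.
  intros H; destruct (rlt_in H) as [Hx Hy].
  destruct (RaddN hK Hx) as (t & Ht & Et).
  assert (E : x + (y + t) = y).
  { rewrite (RaddC hK Hy), (RaddA hK), Et, radd0l; auto. }
  exists (y + t); split; [|exact E].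
  apply rlt_add_cancel with x; auto; rewrite radd0l, (RaddC hK), E; auto.
Qed.

Lemma rmul0 x : x ∈ R -> x * 0 = 0.
Proof using hK.
  intros Hx; apply radd_cancel with (x * 0); auto.
  rewrite <- (RmulD hK), (Radd0 hK), radd0l; auto.
Qed.

(** If 1 <= 0, then -1 >= 0, so 1 = (-1)(-1) >= 0 and 1 = 0. *)
Lemma rlt01 : 0 < 1.
Proof using hK.
  destruct (rle_or_lt R1 R0) as [H|H]; [|exact H]; exfalso.
  destruct (RaddN hK R1) as (t & Ht & Et).
  assert (Ht0 : 0 <= t).
  { rewrite <- Et, <- (radd0l Ht); rewrite (radd0l Ht) at 1.
    now apply (Rle_add hK). }
  pose proof (Rle_mul hK Ht0 Ht0) as Hm.
  assert (E : t * t = 1).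
  { apply radd_cancel with t; auto; rewrite Et.
    rewrite <- (Rmul1 hK Ht) at 3; rewrite <- (RmulD hK), (RaddC hK), Et; auto.
    now apply rmul0. }
  rewrite E in Hm; apply (Rone_neq0 hK), (Rle_antisym hK); auto.
Qed.

Lemma rhalf_ex x : x ∈ R -> exists y, y ∈ R /\ y + y = x.
Proof using hK.
  intros Hx; destruct (RmulV hK (radd_in R1 R1)) as (h & Hh & Eh).
  - intros E; apply (rlt_not_le (rlt_add2 rlt01 rlt01)).
    rewrite E, (Radd0 hK R0); now apply rle_refl.
  - exists (x * h); split; auto.
    rewrite <- (RmulD hK) by auto; rewrite <- (Rmul1 hK Hh).
    rewrite <- (RmulD hK), (RmulC hK Hh), Eh, (Rmul1 hK); auto.
Qed.

Lemma rdouble_inj x y : x ∈ R -> y ∈ R -> x + x = y + y -> x = y.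
Proof using hK.
  assert (H : forall x y, x < y -> x + x <> y + y)
    by (intros u v H; exact (proj2 (rlt_add2 H H))).
  intros Hx Hy E; destruct (rle_or_lt Hx Hy) as [h|h].
  - apply NNPP; intros N; apply (H x y); [split|]; auto.
  - now destruct (H _ _ h).
Qed.

Local Notation hl := (pow2neg K).

Lemma halves_spec : is_fun (halves K) (omega M) R /\ hl (empty M) = 1 /\
  forall n, n ∈ omega M -> hl (succ n) + hl (succ n) = hl n.
Proof using hK.
  refine (epsilon_spec (ZF_model_inhabited M) (fun h => is_fun h (omega M) R /\
    app h (empty M) = 1 /\ forall n, n ∈ omega M ->
    app h (succ n) + app h (succ n) = app h n) _).
  (* Halving is recursion along the relation y + y = x, which is functional by [rdouble_inj]. *)
  set (G := fun n x y : M => opair (opair y y) x ∈ Radd K).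
  assert (HG : def3 G) by (unfold G; defn).
  assert (Gfun : forall n a b b', n ∈ omega M -> a ∈ R -> b ∈ R -> b' ∈ R ->
    G n a b -> G n a b' -> b = b').
  { unfold G; intros n a b b' _ Ha Hb Hb' H H'; apply radd_graph in H, H'.
    destruct H as (_ & _ & ->), H' as (_ & _ & H'); now apply rdouble_inj. }
  assert (Gtot : forall n a, n ∈ omega M -> a ∈ R -> exists b, b ∈ R /\ G n a b).
  { intros n a _ Ha; destruct (rhalf_ex Ha) as (b & Hb & E); exists b; split; auto.
    apply radd_graph; auto. }
  destruct (@fun_ex M (recrel R 1 G) (omega M) R) as (h & Hf & Hh).
  - now apply recrel_def.
  - intros n Hn; destruct (recrel_total R1 HG Gtot Hn) as [a Ha].
    exists a; split; auto; apply Ha.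
  - intros n x y Hn _ _; now apply (recrel_unique R1 HG Gfun).
  - exists h; repeat split; auto; try apply Hf.
    + apply (app_eq Hf), Hh; auto using omega0, recrel0.
    + intros n Hn; pose proof (proj1 (Hh _ _) (app_opair Hf Hn)) as (_ & _ & H).
      pose proof (proj1 (Hh _ _) (app_opair Hf (omegaS Hn))) as (_ & _ & H').
      pose proof (recrel_next R1 HG Gfun H H') as E; unfold G in E.
      apply radd_graph in E; symmetry; tauto.
Qed.

Lemma pow2neg_in n : n ∈ omega M -> hl n ∈ R.
Proof using hK. exact (app_in (proj1 halves_spec)). Qed.
Local Hint Resolve pow2neg_in : core.

Lemma pow2neg_graph n x : opair n x ∈ halves K <-> n ∈ omega M /\ x = hl n.
Proof using hK.
  split.
  - intros H; split; [exact (proj1 (fun_dom (proj1 halves_spec) H))|].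
    symmetry; exact (app_eq (proj1 halves_spec) H).
  - intros [Hn ->]; exact (app_opair (proj1 halves_spec) Hn).
Qed.

Lemma pow2neg_double n : n ∈ omega M -> hl (succ n) + hl (succ n) = hl n.
Proof using hK. apply halves_spec. Qed.

Lemma pow2neg_pos n : n ∈ omega M -> 0 < hl n.
Proof using hK.
  (* The claim is restated through the graph of the powers, in a form to which induction on [omega]
     applies. *)
  intros Hn; enough (~ exists r, opair n r ∈ halves K /\ r <= 0) as H.
  { destruct (rle_or_lt (pow2neg_in Hn) R0) as [h|h]; auto; destruct H.
    exists (hl n); rewrite pow2neg_graph; auto. }
  revert n Hn; unfold rle; omega_elim.
  - intros (r & H & H'); apply pow2neg_graph in H as [_ ->].
    rewrite (proj1 (proj2 halves_spec)) in H'; exact (rlt_not_le rlt01 H').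
  - intros n Hn IH (r & H & H'); apply pow2neg_graph in H as [_ ->]; apply IH.
    exists (hl n); rewrite pow2neg_graph; split; auto.
    rewrite <- (pow2neg_double Hn), <- (Radd0 hK R0); now apply rle_add2.
Qed.

Lemma pow2neg_lt n m : m ∈ omega M -> n ∈ m -> hl m < hl n.
Proof using hK.
  intros Hm Hn.
  enough (forall r, opair n r ∈ halves K -> forall t, opair m t ∈ halves K -> t < r) as H.
  { assert (n ∈ omega M) by (now apply (omega_sub Hm)).
    apply H; rewrite pow2neg_graph; auto. }
  revert m Hm Hn; unfold rlt, rle; omega_elim.
  - intros H; now apply empty_spec in H.
  - intros m Hm IH Hn r Hr t Ht.
    apply pow2neg_graph in Ht as [_ ->].
    assert (L : hl (succ m) < hl m).
    { rewrite <- (pow2neg_double Hm), <- (radd0l (pow2neg_in (omegaS Hm))) at 1.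
      apply rlt_add_r; auto using omegaS, pow2neg_pos. }
    apply succ_spec in Hn as [Hn| ->].
    + apply rle_lt_trans with (hl m); [apply L|].
      apply (IH Hn r Hr); now apply pow2neg_graph.
    + apply pow2neg_graph in Hr as [_ ->]; exact L.
Qed.

(* If s is the supremum of the lower bounds of all 2^-n, then s + s is such a
   lower bound as well. *)
Lemma archimedean t : 0 < t -> exists n, n ∈ omega M /\ hl n < t.
Proof using hK.
  intros Ht; destruct (rlt_in Ht) as [_ HtR].
  apply NNPP; intros Hno.
  destruct (sep (P := fun x => forall n r, opair n r ∈ halves K ->
    opair x r ∈ Rle_rel K) R) as [a Ha]; [defn|].
  assert (Ha' : forall x, x ∈ a <-> x ∈ R /\ forall n, n ∈ omega M -> x <= hl n).
  { intros x; rewrite Ha; split; intros [H H']; split; auto.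
    - intros n Hn; apply (H' n); now apply pow2neg_graph.
    - intros n r Hr; apply pow2neg_graph in Hr as [Hn ->]; now apply H'. }
  assert (Hta : t ∈ a).
  { apply Ha'; split; auto; intros n Hn.
    destruct (rle_or_lt HtR (pow2neg_in Hn)); auto; destruct Hno; eauto. }
  destruct (Rle_sup hK (a := a)) as (s & (Hs & Hub) & Hl).
  - intros x Hx; now apply Ha' in Hx.
  - now exists t.
  - exists (hl (empty M)); split; [auto using omega0|].
    intros x Hx; apply Ha' in Hx as [_ Hx]; auto using omega0.
  - assert (Hsn : forall n, n ∈ omega M -> s <= hl n).
    { intros n Hn; apply Hl; split; auto; intros x Hx; apply Ha' in Hx as []; auto. }
    assert (Hss : s + s <= s).
    { apply Hub, Ha'; split; auto; intros n Hn.
      rewrite <- (pow2neg_double Hn); apply rle_add2; auto using omegaS. }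
    rewrite <- (radd0l Hs) in Hss at 3; apply rle_add_cancel in Hss; auto.
    apply (rlt_not_le Ht), (Rle_trans hK) with s; auto.
Qed.

Lemma inf_ex a : subset a R -> nonempty a -> (forall x, x ∈ a -> 0 <= x) ->
  exists s, s ∈ R /\ (forall x, x ∈ a -> s <= x) /\
    forall l, l ∈ R -> (forall x, x ∈ a -> l <= x) -> l <= s.
Proof using hK.
  intros Ha [x0 Hx0] H0.
  destruct (sep (P := fun l => forall x, x ∈ a -> opair l x ∈ Rle_rel K) R)
    as [L HL]; [defn|].
  destruct (Rle_sup hK (a := L)) as (s & (Hs & Hub) & Hl).
  - intros x Hx; now apply HL in Hx.
  - exists 0; now apply HL.
  - exists x0; split; auto; intros l Hl; apply HL in Hl as [_ Hl]; now apply Hl.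
  - exists s; repeat split; auto.
    + intros x Hx; apply Hl; split; auto; intros l Hl'; apply HL in Hl' as [_ Hl'].
      now apply Hl'.
    + intros l Hl' H; apply Hub, HL; auto.
Qed.

End RealArithmetic.

(** Induction on the number of members treated so far: each step uses one witness and takes a
    maximum, so finitely many witnesses are never chosen simultaneously. *)
Lemma finite_bound (M : ZF_model) (G : M) (P : M -> M -> Prop) : def2 P ->
  finite_set G -> (forall U, U ∈ G -> exists n, n ∈ omega M /\ P U n) ->
  (forall U n, n ∈ omega M -> P U n -> P U (succ n)) ->
  exists N, N ∈ omega M /\ forall U, U ∈ G -> P U N.
Proof.
  intros HP (k & Hk & f & Hf & Hb) Hex Hmono.
  enough (H : forall j, j ∈ omega M -> exists N, N ∈ omega M /\
    forall U i, opair U i ∈ f -> i ∈ j -> P U N).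
  { destruct (H k Hk) as (N & HN & HPN); exists N; split; auto; intros U HU.
    exact (HPN U _ (app_opair Hf HU) (app_in Hf HU)). }
  assert (Hup : forall U n m, m ∈ omega M -> (n = m \/ n ∈ m) -> P U n -> P U m).
  { intros U n m Hm [->|Hn]; auto.
    apply (@omega_mono M (P U)); [defn|auto|auto|auto]. }
  omega_elim.
  - exists (empty M); split; [apply omega0|].
    intros U i _ Hi; now apply empty_spec in Hi.
  - intros j Hj (N & HN & IH).
    destruct (classic (exists U, opair U j ∈ f)) as [[U HU]|Hno].
    + destruct (fun_dom Hf HU) as [HUG Hjk].
      destruct (Hex U HUG) as (n & Hn & HPn).
      destruct (omega_max HN Hn) as (m & Hm & HNm & Hnm).
      exists m; split; auto; intros V i HV Hi; apply succ_spec in Hi as [Hi| ->].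
      * apply (Hup V N); eauto.
      * destruct (Hb j Hjk) as (W & _ & HW).
        rewrite <- (HW V HV), (HW U HU); eauto.
    + exists N; split; auto; intros V i HV Hi; apply succ_spec in Hi as [Hi| ->];
        [eauto|destruct Hno; eauto].
Qed.

(** * Compact quasi-uniform spaces *)

Section QuasiUniform.
Variable M : ZF_model.
Implicit Types a c f x y z u v w n m i j k s e A C D K U V W : M.
Variables (X T T' : M) (B : M -> M -> M -> Prop).

(* [B n x y] abstracts [d x y < 2^-n]. *)
Record quasi_uniform : Prop := {
  qu_def : def3 B;
  qu_in : forall n x y, B n x y -> n ∈ omega M /\ x ∈ X /\ y ∈ X;
  qu_refl : forall n x, n ∈ omega M -> x ∈ X -> B n x x;
  qu_tri : forall n x y z, n ∈ omega M -> B (succ n) x z -> B (succ n) z y -> B n x y;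
  qu_open : forall n x y, B n x y ->
    exists m, m ∈ omega M /\ forall z, B m y z -> B n x z;
  qu_open' : forall n x y, B n x y ->
    exists m, m ∈ omega M /\ forall z, B m z x -> B n z y;
  qu_sep : forall x y, x ∈ X -> y ∈ X -> (forall n, n ∈ omega M -> B n x y) -> x = y;
  qu_top : forall V, V ∈ T <-> subset V X /\
    forall x, x ∈ V -> exists n, n ∈ omega M /\ forall y, B n x y -> y ∈ V;
  qu_top' : forall V, V ∈ T' <-> subset V X /\
    forall x, x ∈ V -> exists n, n ∈ omega M /\ forall y, B n y x -> y ∈ V
}.

Hypothesis hB : quasi_uniform.
Hypothesis Xcompact : compact X T.

Let Bdef := qu_def hB.
Local Hint Resolve Bdef : defn.

Lemma qu_le n m x y : m ∈ omega M -> (n = m \/ n ∈ m) -> B m x y -> B n x y.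
Proof using hB.
  intros Hm [->|Hn]; auto.
  apply (@omega_mono M (fun m => B m x y -> B n x y)) with n; auto; [defn|].
  intros k Hk IH H; apply IH; destruct (qu_in hB H) as (_ & Hx & Hy).
  apply (qu_tri hB Hk H), (qu_refl hB); auto using omegaS.
Qed.

Lemma ball_ex n x : n ∈ omega M -> x ∈ X ->
  exists U, U ∈ T /\ (forall z, z ∈ U <-> B n x z).
Proof using hB.
  intros Hn Hx; destruct (sep (P := B n x) X) as [U HU]; [defn|].
  assert (HU' : forall z, z ∈ U <-> B n x z).
  { intros z; rewrite HU; split; [tauto|]; intros H; split; auto.
    now apply (qu_in hB) in H. }
  exists U; split; auto; apply (qu_top hB); split.
  - intros z Hz; now apply HU in Hz.
  - intros z Hz; apply HU' in Hz; destruct (qu_open hB Hz) as (m & Hm & H).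
    exists m; split; auto; intros y Hy; apply HU'; auto.
Qed.

Lemma ball_ex' n y : n ∈ omega M -> y ∈ X ->
  exists U, U ∈ T' /\ (forall z, z ∈ U <-> B n z y).
Proof using hB.
  intros Hn Hx; destruct (sep (P := fun z => B n z y) X) as [U HU]; [defn|].
  assert (HU' : forall z, z ∈ U <-> B n z y).
  { intros z; rewrite HU; split; [tauto|]; intros H; split; auto.
    now apply (qu_in hB) in H. }
  exists U; split; auto; apply (qu_top' hB); split.
  - intros z Hz; now apply HU in Hz.
  - intros z Hz; apply HU' in Hz; destruct (qu_open' hB Hz) as (m & Hm & H).
    exists m; split; auto; intros w Hw; apply HU'; auto.
Qed.

(** If no point clusters, the open sets that miss some [C n] cover [X]. The members of a finite
    subcover miss a common [C N], which is non-empty. *)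
Lemma cluster (C : M -> M -> Prop) : def2 C ->
  (forall n, n ∈ omega M -> exists z, z ∈ X /\ C n z) ->
  (forall n z, n ∈ omega M -> C (succ n) z -> C n z) ->
  exists w, w ∈ X /\ forall n, n ∈ omega M -> exists z, B n w z /\ C n z.
Proof using hB Xcompact.
  intros HC Hne Hdec; apply NNPP; intros Hno.
  destruct (sep (P := fun U => exists n, n ∈ omega M /\ forall z, z ∈ U -> ~ C n z) T)
    as [F HF]; [defn|].
  destruct (Xcompact (F := F)) as (G & HGF & HG & Hcov).
  - intros U HU; now apply HF in HU.
  - intros w Hw; apply bigunion_spec.
    assert (Hn : exists n, n ∈ omega M /\ forall z, B n w z -> ~ C n z).
    { apply NNPP; intros Hn; apply Hno; exists w; split; auto; intros n Hn'.
      apply NNPP; intros Hz; apply Hn; exists n; split; auto; intros z H1 H2.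
      apply Hz; eauto. }
    destruct Hn as (n & Hn & H); destruct (ball_ex Hn Hw) as (U & HU & HUB).
    exists U; split; [|apply HUB, (qu_refl hB); auto].
    apply HF; split; auto; exists n; split; auto; intros z Hz; apply H, HUB, Hz.
  - destruct (@finite_bound M G (fun U n => forall z, z ∈ U -> ~ C n z))
      as (N & HN & H); auto; [defn| | |].
    + intros U HU; now apply HGF, HF in HU.
    + intros U n Hn H z Hz Hz'; apply (H z); auto.
    + destruct (Hne N HN) as (z & Hz & HCz).
      destruct (proj1 (bigunion_spec _ _) (Hcov z Hz)) as (U & HU & HzU).
      exact (H U HU z HzU HCz).
Qed.

(* A cluster point [w] of points [z] outside [U] with [d z y] small satisfies
   [d w y = 0]. *)
Lemma conj_nbhd U y : U ∈ T -> y ∈ U ->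
  exists n, n ∈ omega M /\ forall x, B n x y -> x ∈ U.
Proof using hB Xcompact.
  intros HU Hy; apply NNPP; intros Hno.
  assert (HyX : y ∈ X) by (apply (qu_top hB) in HU; now apply HU).
  destruct (@cluster (fun n z => ~ z ∈ U /\ B n z y)) as (w & Hw & H); [defn| | |].
  - intros n Hn; apply NNPP; intros Hz; apply Hno; exists n; split; auto.
    intros x Hx; apply NNPP; intros HxU; apply Hz; exists x.
    split; auto; now apply (qu_in hB) in Hx.
  - intros n z Hn [H H']; split; auto; apply (qu_le (m := succ n)); auto using omegaS.
    right; apply succ_spec; auto.
  - assert (E : w = y).
    { apply (qu_sep hB); auto; intros n Hn; destruct (H _ (omegaS Hn)) as (z & H1 & _ & H2).
      exact (qu_tri hB Hn H1 H2). }
    subst w; apply (qu_top hB) in HU as [_ HU]; destruct (HU y Hy) as (n & Hn & HnU).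
    destruct (H n Hn) as (z & Hz & HzU & _); auto.
Qed.

Lemma conj_finer U : U ∈ T -> U ∈ T'.
Proof using hB Xcompact.
  intros HU; apply (qu_top' hB); split; [now apply (qu_top hB) in HU|].
  intros x Hx; exact (conj_nbhd HU Hx).
Qed.

Lemma separable_of_conj : separable X T' -> separable X T.
Proof using hB Xcompact.
  intros (D & HD & Hs & Hd); exists D; repeat split; auto.
  intros U HU; apply Hd, conj_finer, HU.
Qed.

Lemma second_countable_of_conj : separable X T' -> second_countable T.
Proof using hB Xcompact.
  intros (D & HD & Hs & Hd).
  destruct (countable_enum HD) as (f & Hfun & Hf & Hsurj).
  destruct (sep (P := fun U => exists x n, x ∈ D /\ n ∈ omega M /\
    forall z, z ∈ U <-> B n x z) T) as [Bs HBs]; [defn|].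
  exists Bs; split; [|split].
  - apply (@countable_image2 M (fun i n U => exists x, opair i x ∈ f /\
      forall z, z ∈ U <-> B n x z)).
    + defn.
    + intros i n U V _ _ (x & Hx & HU) (x' & Hx' & HV).
      rewrite (Hfun _ _ _ Hx' Hx) in HV; apply set_ext; intros z.
      now rewrite HU, HV.
    + intros U HU; apply HBs in HU as (_ & x & n & Hx & Hn & HU).
      destruct (Hsurj x Hx) as (i & Hi & Hix); eauto 8.
  - intros U HU; now apply HBs in HU.
  - intros U y HU Hy.
    assert (HyX : y ∈ X) by (apply (qu_top hB) in HU; now apply HU).
    destruct (proj2 (proj1 (qu_top hB U) HU) y Hy) as (m & Hm & HmU).
    destruct (ball_ex (omegaS Hm) HyX) as (V & HV & HVB).
    destruct (conj_nbhd HV (y := y)) as (n & Hn & HnV).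
    { apply HVB, (qu_refl hB); auto using omegaS. }
    (* The index [k] serves twice: a point [x] of [D] with [B k x y] lies in the (m+1)-ball of [y],
       and the [k]-ball of [x] is small enough for the triangle inequality to keep it in [U]. *)
    destruct (omega_max (omegaS Hm) Hn) as (k & Hk & Hmk & Hnk).
    destruct (ball_ex' Hk HyX) as (O & HO & HOB).
    destruct (Hd O HO) as (x & Hx).
    { exists y; apply HOB, (qu_refl hB); auto. }
    apply inter_spec in Hx as [HxO HxD]; apply HOB in HxO.
    destruct (ball_ex Hk (Hs x HxD)) as (W & HW & HWB).
    exists W; split; [|split].
    + apply HBs; split; auto; exists x, k; auto.
    + now apply HWB.
    + intros z Hz; apply HmU; apply (qu_tri hB Hm (z := x)).
      * apply HVB, HnV, (qu_le (m := k)); auto.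
      * apply (qu_le (m := k)); auto; now apply HWB.
Qed.

Definition adherent W y : Prop :=
  y ∈ X /\ forall m, m ∈ omega M -> exists x, B m y x /\ x ∈ W.

Lemma adherent_def : def2 adherent.
Proof using hB. unfold adherent; defn. Qed.
Local Hint Resolve adherent_def : defn.

Lemma adherent_closed A w : closed X T A -> adherent A w -> w ∈ A.
Proof using hB.
  intros [HA HT] [Hw H]; apply NNPP; intros HwA.
  destruct (proj2 (proj1 (qu_top hB _) HT) w) as (n & Hn & Hn').
  - now apply diff_spec.
  - destruct (H n Hn) as (x & Hx & HxA); apply Hn' in Hx.
    now apply diff_spec in Hx.
Qed.

Lemma adherent_of A w : w ∈ X -> w ∈ A -> adherent A w.
Proof using hB.
  intros Hw H; split; auto; intros m Hm; exists w; split; auto.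
  now apply (qu_refl hB).
Qed.

Lemma adherent_adherent A C w :
  (forall x, x ∈ C -> adherent A x) -> adherent C w -> adherent A w.
Proof using hB.
  intros HAC [Hw H]; split; auto; intros m Hm.
  destruct (H _ (omegaS Hm)) as (x & Hx & HxC).
  destruct (proj2 (HAC x HxC) _ (omegaS Hm)) as (y & Hy & HyA).
  exists y; split; auto; exact (qu_tri hB Hm Hx Hy).
Qed.

Lemma closed_adherent A : subset A X -> (forall w, adherent A w -> w ∈ A) ->
  closed X T A.
Proof using hB.
  intros HA H; split; auto; apply (qu_top hB); split.
  - intros x Hx; now apply diff_spec in Hx.
  - intros x Hx; apply diff_spec in Hx as [Hx HxA]; apply NNPP; intros Hno.
    apply HxA, H; split; auto; intros m Hm; apply NNPP; intros Hno'.
    apply Hno; exists m; split; auto; intros y Hy; apply diff_spec; split.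
    + now apply (qu_in hB) in Hy.
    + intros HyA; apply Hno'; eauto.
Qed.

Lemma closed_family_spec a :
  a ∈ {{ a | closed X T a /\ nonempty a }} <-> closed X T a /\ nonempty a.
Proof using.
  apply (@compr_sep M (fun a => closed X T a /\ nonempty a) (power X)).
  - unfold closed; defn.
  - intros x [[H _] _]; now apply power_spec.
Qed.

(** * From a countable base to a Loeb function *)

Section LoebOfBase.
Variables (e : M).
Hypothesis e_fun : forall n W W', opair n W ∈ e -> opair n W' ∈ e -> W = W'.
Hypothesis e_base : forall U x, U ∈ T -> x ∈ U ->
  exists n W, n ∈ omega M /\ opair n W ∈ e /\ x ∈ W /\ subset W U.
Hypothesis XT2 : hausdorff X T.

(* Iterated over all basic sets, this cuts a closed set down to one point. *)
Definition shrink n a a' : Prop := forall x, x ∈ a' <-> x ∈ a /\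
  ((exists W y, opair n W ∈ e /\ y ∈ a /\ adherent W y) ->
   exists W, opair n W ∈ e /\ adherent W x).

Lemma shrink_def : def3 shrink.
Proof using hB. unfold shrink; defn. Qed.
Local Hint Resolve shrink_def : defn.

Lemma shrink_fun n a b b' : n ∈ omega M -> a ∈ power X -> b ∈ power X ->
  b' ∈ power X -> shrink n a b -> shrink n a b' -> b = b'.
Proof using.
  intros _ _ _ _ H H'; apply set_ext; intros x; now rewrite (H x), (H' x).
Qed.

Lemma shrink_total n a : n ∈ omega M -> a ∈ power X ->
  exists b, b ∈ power X /\ shrink n a b.
Proof using hB.
  intros Hn Ha; destruct (sep (P := fun x =>
    (exists W y, opair n W ∈ e /\ y ∈ a /\ adherent W y) ->
    exists W, opair n W ∈ e /\ adherent W x) a) as [b Hb]; [defn|].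
  exists b; split; auto; apply power_spec; intros x Hx; apply Hb in Hx as [Hx _].
  rewrite power_spec in Ha; auto.
Qed.

Local Notation seq A := (recrel (power X) A shrink).

(** The new set is [a] itself or the intersection of [a] with the closure of one basic set, the
    latter only when that intersection is non-empty. *)
Lemma shrink_closed n a a' : n ∈ omega M -> shrink n a a' ->
  closed X T a /\ nonempty a -> closed X T a' /\ nonempty a'.
Proof using hB e_fun.
  intros Hn Hs [Ha [x Hx]]; split.
  - apply closed_adherent; [intros y Hy; apply Ha; now apply Hs in Hy|].
    intros w Hw; apply Hs; split.
    + apply (adherent_closed Ha), adherent_adherent with a'; auto.
      intros y Hy; apply Hs in Hy as [Hy _]; apply adherent_of; auto; now apply Ha.
    + intros (W & y & HW & Hy); exists W; split; auto.
      apply adherent_adherent with a'; auto; intros z Hz; apply Hs in Hz as [_ Hz].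
      destruct Hz as (W' & HW' & Hz); [eauto|]; now rewrite (e_fun HW HW').
  - destruct (classic (exists W y, opair n W ∈ e /\ y ∈ a /\ adherent W y)) as [H|H].
    + destruct H as (W & y & HW & Hy & Had); exists y; apply Hs; split; eauto.
    + exists x; apply Hs; split; tauto.
Qed.

(** The stages are closed and decreasing, so a cluster point lies in all of them. A second common
    point would be separated from it by the closure of some basic set, and the stage of that set
    would have removed it. *)
Lemma shrink_point A : closed X T A -> nonempty A ->
  exists! x, forall n a, seq A n a -> x ∈ a.
Proof using hB e_fun e_base XT2 Xcompact.
  intros HA HA'.
  assert (HAX : A ∈ power X) by apply power_spec, HA.
  assert (Hd := shrink_def).
  assert (Hseq : def2 (seq A)) by now apply recrel_def.
  assert (Hcl : forall n a, seq A n a -> closed X T a /\ nonempty a).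
  { apply (recrel_ind HAX Hd); auto.
    - unfold closed; defn.
    - intros n a b HR H _ Hs; apply (shrink_closed (proj1 HR) Hs H). }
  assert (Htot : forall n, n ∈ omega M -> exists a, seq A n a)
    by (intros n; apply (recrel_total HAX Hd shrink_total)).
  assert (Hnext : forall n a b, seq A n a -> seq A (succ n) b -> shrink n a b)
    by (intros n a b; apply (recrel_next HAX Hd shrink_fun)).
  assert (Hdec : forall n a b x, seq A n a -> seq A (succ n) b -> x ∈ b -> x ∈ a).
  { intros n a b x H H' Hx; now apply (Hnext n a b H H') in Hx. }
  assert (Hdec' : forall n z, n ∈ omega M ->
    (exists a, seq A (succ n) a /\ z ∈ a) -> exists a, seq A n a /\ z ∈ a).
  { intros n z Hn (b & Hb & Hz); destruct (Htot n Hn) as (a & Ha); eauto. }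
  destruct (@cluster (fun n z => exists a, seq A n a /\ z ∈ a)) as (w & Hw & H).
  - defn.
  - intros n Hn; destruct (Htot n Hn) as (a & Ha).
    destruct (Hcl n a Ha) as [[HaX _] [z Hz]].
    exists z; split; [now apply HaX|eauto].
  - exact Hdec'.
  - assert (Hwa : forall n a, seq A n a -> w ∈ a).
    { intros n a Ha; apply adherent_closed; [now apply (Hcl n)|].
      (* The cluster property is used at an index above both [m] and [n], then weakened in the
         radius and in the stage. *)
      split; auto; intros m Hm; destruct (omega_max Hm (proj1 Ha)) as (k & Hk & Hmk & Hnk).
      destruct (H k Hk) as (z & Hz & HC); exists z; split.
      - exact (qu_le Hk Hmk Hz).
      - enough (exists b, seq A n b /\ z ∈ b) as (b & Hb & Hzb).
        { now rewrite (recrel_unique HAX Hd shrink_fun Ha Hb). }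
        destruct Hnk as [->|Hnk]; auto; revert HC.
        apply (@omega_mono M (fun k => (exists a, seq A k a /\ z ∈ a) ->
          exists b, seq A n b /\ z ∈ b)) with n; auto; defn. }
    exists w; split; auto; intros w' Hw'; apply NNPP; intros Hne.
    assert (HwX' : w' ∈ X).
    { apply HA, (Hw' (empty M)); now apply recrel0. }
    destruct (XT2 Hw HwX' Hne) as (U & V & HU & HV & HwU & HwV & Hdis).
    destruct (e_base HU HwU) as (n & W & Hn & HW & HwW & HWU).
    destruct (Htot n Hn) as (a & Ha), (Htot _ (omegaS Hn)) as (b & Hb).
    (* As [w] lies in [W] and in stage [n], the next stage keeps only points of the closure of
       [W]. *)
    destruct (proj2 (proj1 (Hnext n a b Ha Hb w') (Hw' _ _ Hb))) as (W' & HW' & Had).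
    { exists W, w; repeat split; eauto; now apply adherent_of. }
    rewrite (e_fun HW' HW) in Had.
    destruct (proj2 (proj1 (qu_top hB V) HV) w' HwV) as (m & Hm & HmV).
    destruct (proj2 Had m Hm) as (x & Hx & HxW).
    apply Hdis; exists x; apply inter_spec; auto.
Qed.

Lemma loeb_of_enum : loeb X T.
Proof using hB e_fun e_base XT2 Xcompact.
  right; set (F := {{ a | closed X T a /\ nonempty a }}).
  assert (HF : forall a, a ∈ F <-> closed X T a /\ nonempty a)
    by exact closed_family_spec.
  destruct (@fun_ex M (fun A x => x ∈ A /\ forall n a, seq A n a -> x ∈ a)
    F (bigunion F)) as (f & Hf & Hf').
  - unfold recrel; defn.
  - intros A HA; assert (HA' := HA); apply HF in HA' as [HA1 HA2].
    destruct (shrink_point HA1 HA2) as (x & Hx & _).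
    assert (HxA : x ∈ A).
    { apply (Hx (empty M)), recrel0, power_spec, HA1. }
    exists x; repeat split; auto; apply bigunion_spec; eauto.
  - intros A x y HA _ _ [_ Hx] [_ Hy]; apply HF in HA as [HA1 HA2].
    destruct (shrink_point HA1 HA2) as (z & _ & Hz).
    now rewrite <- (Hz x Hx), <- (Hz y Hy).
  - exists f; split; auto; intros A HA.
    now apply (Hf' A (app f A)), app_opair with (b := bigunion F) (a := F).
Qed.

End LoebOfBase.

Lemma loeb_of_second_countable : hausdorff X T -> second_countable T -> loeb X T.
Proof using hB Xcompact.
  intros HT2 (Bs & HBs & HBT & Hbase).
  destruct (countable_enum HBs) as (e & Hfun & He & Hsurj).
  apply (loeb_of_enum (e := e)); auto.
  intros U x HU Hx; destruct (Hbase U x HU Hx) as (W & HW & HxW & HWU).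
  destruct (Hsurj W HW) as (n & Hn & HnW); eauto 8.
Qed.

End QuasiUniform.

(** * From a Loeb function to a countable set dense for the conjugate *)

Section Greedy.
Variable M : ZF_model.
Implicit Types a c f x y z u v w n m i j k s e A C D K U V W : M.
Variables (X T T' : M) (B : M -> M -> M -> Prop).
Hypothesis hB : quasi_uniform X T T' B.
Hypothesis Xcompact : compact X T.

Let Bdef := qu_def hB.
Local Hint Resolve Bdef : defn.

(* [K] is covered by the members, each inside an [n]-ball, of a sequence of
   length [k]; no centres are chosen. *)
Definition covered n k K : Prop := exists s,
  (forall i U U', opair i U ∈ s -> opair i U' ∈ s -> U = U') /\
  (forall i U, opair i U ∈ s -> exists x, x ∈ X /\ forall y, y ∈ U -> B n x y) /\
  forall y, y ∈ K -> exists i U, i ∈ k /\ opair i U ∈ s /\ y ∈ U.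

Lemma covered_def : def3 covered.
Proof using hB. unfold covered; defn. Qed.
Local Hint Resolve covered_def : defn.

Lemma covered_mono n k k' K K' : subset k k' -> subset K' K ->
  covered n k K -> covered n k' K'.
Proof using.
  intros Hk HK (s & H1 & H2 & H3); exists s; repeat split; auto.
  intros y Hy; destruct (H3 y (HK y Hy)) as (i & U & Hi & HU); eauto.
Qed.

Lemma covered0 n k : covered n (empty M) k -> k = empty M.
Proof using.
  intros (s & _ & _ & H); apply set_ext; intros x; split; intros Hx.
  - destruct (H x Hx) as (i & U & Hi & _); now apply empty_spec in Hi.
  - now apply empty_spec in Hx.
Qed.

Lemma coveredS n k K : nonempty X -> covered n (succ k) K ->
  exists x, x ∈ X /\ forall K', (forall y, y ∈ K' -> y ∈ K /\ ~ B n x y) ->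
    covered n k K'.
Proof using.
  intros [x0 Hx0] (s & H1 & H2 & H3).
  assert (Hx : exists x, x ∈ X /\ forall U, opair k U ∈ s ->
    forall y, y ∈ U -> B n x y).
  { destruct (classic (exists U, opair k U ∈ s)) as [[U HU]|Hno].
    - destruct (H2 k U HU) as (x & Hx & HxU); exists x; split; auto.
      intros V HV; now rewrite (H1 k V U HV HU).
    (* The sequence may have no entry at [k]; then any point will do. *)
    - exists x0; split; auto; intros U HU; destruct Hno; eauto. }
  destruct Hx as (x & Hx & HxU); exists x; split; auto.
  intros K' HK'; exists s; repeat split; auto; intros y Hy.
  destruct (HK' y Hy) as [HyK Hyx]; destruct (H3 y HyK) as (i & U & Hi & HU & HyU).
  apply succ_spec in Hi as [Hi| ->]; [eauto|]; destruct Hyx; eauto.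
Qed.

Lemma covered_compact n K : n ∈ omega M -> subset K X ->
  exists k, k ∈ omega M /\ covered n k K.
Proof using hB Xcompact.
  intros Hn HK.
  destruct (sep (P := fun U => exists x, x ∈ X /\ forall y, y ∈ U -> B n x y) T)
    as [F HF]; [defn|].
  destruct (Xcompact (F := F)) as (G & HGF & (k & Hk & g & Hg & Hb) & Hcov).
  - intros U HU; now apply HF in HU.
  - intros x Hx; apply bigunion_spec; destruct (ball_ex hB Hn Hx) as (U & HU & HUB).
    exists U; split; [|apply HUB, (qu_refl hB); auto].
    apply HF; split; auto; exists x; split; auto; intros y; apply HUB.
  - exists k; split; auto.
    destruct (@sep2 M (fun i U => opair U i ∈ g) k G) as [s Hs]; [defn|].
    exists s; repeat split.
    + intros i U U' H H'; apply Hs in H as (Hi & _ & H); apply Hs in H' as (_ & _ & H').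
      destruct (Hb i Hi) as (V & _ & HV); now rewrite <- (HV U H), <- (HV U' H').
    + intros i U H; apply Hs in H as (_ & H & _); now apply HGF, HF in H.
    + intros y Hy; destruct (proj1 (bigunion_spec _ _) (Hcov y (HK y Hy))) as (U & HU & HyU).
      exists (app g U), U; repeat split; auto; [exact (app_in Hg HU)|].
      apply Hs; repeat split; auto; [exact (app_in Hg HU)|exact (app_opair Hg HU)].
Qed.

(* Removing the ball around [x] decreases the covering number of [K]. *)
Definition good_center n K x : Prop := x ∈ X /\ forall k, k ∈ omega M ->
  covered n (succ k) K -> forall K', (forall y, y ∈ K' -> y ∈ K /\ ~ B n x y) ->
  covered n k K'.

Lemma good_center_def : def3 good_center.
Proof using hB. unfold good_center; defn. Qed.
Local Hint Resolve good_center_def : defn.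

(** A centre of the last member of a shortest cover works: after removal the shortest length [m]
    plus one drops to [m], and every longer cover allows more. *)
Lemma good_center_ex n K : nonempty X -> n ∈ omega M -> subset K X ->
  exists x, good_center n K x.
Proof using hB Xcompact.
  intros HX Hn HK.
  destruct (@omega_least M (fun k => covered n k K)) as (k & Hk & Hc & Hmin);
    [defn|now apply covered_compact|].
  destruct (omega_case Hk) as [->|(m & Hm & ->)].
  (* For empty [K] every point is good, so the greedy recursion never stops. *)
  - destruct HX as [x Hx]; exists x; split; auto; intros k _ _ K' HK'.
    apply covered0 in Hc; subst K.
    exists (empty M); repeat split.
    + intros i U U' H; now apply empty_spec in H.
    + intros i U H; now apply empty_spec in H.
    + intros y Hy; destruct (HK' y Hy) as [H _]; now apply empty_spec in H.
  - destruct (coveredS HX Hc) as (x & Hx & HxK); exists x; split; auto.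
    intros j Hj Hcj K' HK'; apply covered_mono with m K'; auto.
    + destruct (omega_total Hm Hj) as [H|[->|H]]; try (intros i Hi; assumption).
      * intros i Hi; exact (omega_trans Hj H Hi).
      (* Here [j] is below [m], so the cover of length [succ j] contradicts minimality. *)
      * destruct (Hmin (succ j)); auto; now apply omegaS_mem.
    + intros i Hi; assumption.
Qed.

Section LoebGreedy.
Variable f : M.
Hypothesis Xnonempty : nonempty X.
Hypothesis f_choice : choice_function f {{ a | closed X T a /\ nonempty a }}.

(** [c] is the closure of the set of good centres, so the chosen point is only a limit of good
    centres. *)
Definition pick n K z : Prop := exists c,
  (forall w, w ∈ c <-> w ∈ X /\
     forall m, m ∈ omega M -> exists x, B m w x /\ good_center n K x) /\
  opair c z ∈ f.

Lemma pick_def : def3 pick.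
Proof using hB. unfold pick; defn. Qed.
Local Hint Resolve pick_def : defn.

Lemma pick_fun n K z z' : pick n K z -> pick n K z' -> z = z'.
Proof using f_choice.
  intros (c & Hc & Hz) (c' & Hc' & Hz').
  assert (E : c = c') by (apply set_ext; intros w; now rewrite Hc, Hc').
  subst c'; exact (fun_unique (proj1 f_choice) Hz Hz').
Qed.

Lemma pick_ex n K : n ∈ omega M -> subset K X -> exists z, pick n K z.
Proof using hB Xcompact Xnonempty f_choice.
  intros Hn HK; destruct (good_center_ex Xnonempty Hn HK) as (x & Hx).
  destruct (sep (P := fun w => forall m, m ∈ omega M ->
    exists x, B m w x /\ good_center n K x) X) as [c Hc]; [defn|].
  exists (app f c), c; split; [exact Hc|].
  apply app_opair with (1 := proj1 f_choice), closed_family_spec; split.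
  - destruct (sep (P := good_center n K) X) as [C HC]; [defn|].
    apply (closed_adherent hB).
    + intros w Hw; now apply Hc in Hw.
    + intros w [Hw H]; apply Hc; split; auto; intros m Hm.
      destruct (H _ (omegaS Hm)) as (y & Hy & Hyc); apply Hc in Hyc as [_ Hyc].
      destruct (Hyc _ (omegaS Hm)) as (u & Hu & Hgu); exists u; split; auto.
      exact (qu_tri hB Hm Hy Hu).
  - exists x; apply Hc; split; [apply Hx|]; intros m Hm; exists x; split; auto.
    apply (qu_refl hB); auto; apply Hx.
Qed.

Lemma pick_in n K z : pick n K z -> z ∈ X /\
  forall m, m ∈ omega M -> exists x, B m z x /\ good_center n K x.
Proof using f_choice.
  intros (c & Hc & Hz); apply Hc.
  rewrite <- (app_eq (proj1 f_choice) Hz); apply (proj2 f_choice).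
  exact (proj1 (fun_dom (proj1 f_choice) Hz)).
Qed.

(** The loss of one index pays for that limit: if [x] is a good centre with [B (succ n) z x], the
    triangle inequality puts the (n+1)-ball of [x] inside the [n]-ball of [z]. *)
Definition remove_ball n (i K K' : M) : Prop :=
  exists z, pick (succ n) K z /\ forall y, y ∈ K' <-> y ∈ K /\ ~ B n z y.

Lemma remove_ball_def n : def3 (remove_ball n).
Proof using hB. unfold remove_ball; defn. Qed.

Lemma remove_ball_fun n i K K' K'' : i ∈ omega M -> K ∈ power X ->
  K' ∈ power X -> K'' ∈ power X ->
  remove_ball n i K K' -> remove_ball n i K K'' -> K' = K''.
Proof using f_choice.
  intros _ _ _ _ (z & Hz & H) (z' & Hz' & H').
  rewrite (pick_fun Hz' Hz) in H'; apply set_ext; intros y; now rewrite H, H'.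
Qed.

Lemma remove_ball_total n : n ∈ omega M -> forall i K, i ∈ omega M -> K ∈ power X ->
  exists K', K' ∈ power X /\ remove_ball n i K K'.
Proof using hB Xcompact Xnonempty f_choice.
  intros Hn i K _ HK; apply power_spec in HK.
  destruct (pick_ex (omegaS Hn) HK) as (z & Hz).
  destruct (sep (P := fun y => ~ B n z y) K) as [K' HK']; [defn|].
  exists K'; split; [|exists z; auto].
  apply power_spec; intros y Hy; apply HK' in Hy as [Hy _]; auto.
Qed.

Local Notation seq n := (recrel (power X) X (remove_ball n)).

(** Induction on the covering number: either the current ball contains [y], or [y] survives in a set
    whose covering number is smaller. *)
Lemma greedy_covers n : n ∈ omega M -> forall k, k ∈ omega M ->
  forall i K, seq n i K -> covered (succ n) k K ->
  forall y, y ∈ K -> exists j L z, seq n j L /\ pick (succ n) L z /\ B n z y.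
Proof using hB Xcompact Xnonempty f_choice.
  intros Hn; pose proof (remove_ball_def n) as Hd.
  unfold recrel; omega_elim.
  - intros i K _ HK y Hy; apply covered0 in HK; subst K; now apply empty_spec in Hy.
  - intros k Hk IH i K HR HK y Hy.
    assert (HKX : K ∈ power X) by apply HR.
    destruct (pick_ex (omegaS Hn) (proj1 (power_spec _ _) HKX)) as (z & Hz).
    destruct (classic (B n z y)) as [Hzy|Hzy]; [exists i, K, z; auto|].
    destruct (remove_ball_total Hn (proj1 HR) HKX) as (K' & HK' & HG).
    apply (IH (succ i) K'); [exact (recrelS HR HK' HG)| |].
    + destruct HG as (z' & Hz' & HzK); rewrite (pick_fun Hz' Hz) in HzK.
      destruct (proj2 (pick_in Hz) _ (omegaS Hn)) as (x & Hzx & Hx).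
      apply (proj2 Hx k Hk HK); intros u Hu; apply HzK in Hu as [Hu Hzu].
      split; auto; intros Hxu; exact (Hzu (qu_tri hB Hn Hzx Hxu)).
    + destruct HG as (z' & Hz' & HzK); rewrite (pick_fun Hz' Hz) in HzK.
      now apply HzK.
Qed.

(** The dense set collects the picks of all scales [n] and all stages [i]. At each scale a pick has
    [y] in its [n]-ball, which is nearness to [y] in the conjugate topology. *)
Lemma conj_separable_of_choice : separable X T'.
Proof using hB Xcompact Xnonempty f_choice.
  assert (HXX : X ∈ power X) by (apply power_spec; now intros x).
  set (P := fun n i z => exists K, seq n i K /\ pick (succ n) K z).
  assert (HP : def3 P) by (unfold P, recrel, remove_ball; defn).
  destruct (sep (P := fun z => exists n i, n ∈ omega M /\ i ∈ omega M /\ P n i z) X)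
    as [D HD]; [defn|].
  exists D; split; [|split].
  - apply (countable_image2 HP).
    + intros n i z z' Hn Hi (K & HK & Hz) (K' & HK' & Hz').
      rewrite (recrel_unique HXX (remove_ball_def n) (@remove_ball_fun n) HK' HK) in Hz'.
      exact (pick_fun Hz Hz').
    + intros z Hz; apply HD in Hz as [_ Hz]; exact Hz.
  - intros z Hz; now apply HD in Hz.
  - intros U HU [y Hy]; apply (qu_top' hB) in HU as [HUX HU].
    destruct (HU y Hy) as (n & Hn & HnU).
    destruct (covered_compact (omegaS Hn) (K := X)) as (k & Hk & Hc); [now intros x|].
    destruct (greedy_covers Hn Hk (recrel0 _ HXX) Hc (HUX y Hy))
      as (j & L & z & HR & Hz & Hzy).
    exists z; apply inter_spec; split; auto; apply HD; split; [now apply pick_in in Hz|].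
    exists n, j; split; [exact Hn|split; [apply HR|exists L; auto]].
Qed.

End LoebGreedy.

Lemma conj_separable_of_loeb : loeb X T -> separable X T'.
Proof using hB Xcompact.
  destruct (classic (nonempty X)) as [HX|HX].
  - intros [E|[f Hf]]; [|exact (conj_separable_of_choice HX Hf)].
    destruct HX as [x Hx]; rewrite E in Hx; now apply empty_spec in Hx.
  - intros _; assert (E : forall x, ~ x ∈ X) by (intros x Hx; apply HX; now exists x).
    exists X; split; [|split].
    + apply (@countable_image M (fun _ _ => False)); [defn|tauto|].
      intros z Hz; now apply E in Hz.
    + now intros x.
    + intros U HU [x Hx]; apply (qu_top' hB) in HU as [HU _]; now apply HU, E in Hx.
Qed.

End Greedy.

(** * Entourages *)

Section NormalSequence.
Variable M : ZF_model.
Implicit Types x y z u v w n m i j k s U W : M.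

(** The hypotheses of Frink's metrization lemma. The condition at 0 guarantees that any two points
    are joined by a chain; the threefold composition matches cutting a chain into a left part, one
    step and a right part. *)
Record normal_sequence (X : M) (V : M -> M -> M -> Prop) : Prop := {
  ns_def : def3 V;
  ns_in : forall k x y, V k x y -> x ∈ X /\ y ∈ X;
  ns_refl : forall k x, x ∈ X -> V k x x;
  ns_sym : forall k x y, V k x y -> V k y x;
  ns_zero : forall x y, x ∈ X -> y ∈ X -> V (empty M) x y;
  ns_comp : forall k x y z w, k ∈ omega M ->
    V (succ k) x y -> V (succ k) y z -> V (succ k) z w -> V k x w
}.

Variables (X T T' : M) (B : M -> M -> M -> Prop).
Hypothesis hB : quasi_uniform X T T' B.
Hypothesis Xcompact : compact X T.
Hypothesis XT2 : hausdorff X T.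

Let Bdef := qu_def hB.
Local Hint Resolve Bdef : defn.

Definition entourage n x y : Prop := exists z, B n z x /\ B n z y.

Lemma entourage_def : def3 entourage.
Proof using hB. unfold entourage; defn. Qed.
Local Hint Resolve entourage_def : defn.

Lemma entourage_le n m x y : m ∈ omega M -> (n = m \/ n ∈ m) ->
  entourage m x y -> entourage n x y.
Proof using hB.
  intros Hm Hnm (z & Hx & Hy); exists z; split; now apply (qu_le hB Hm Hnm).
Qed.

(** The common centre [z] satisfies a smallness condition on d(z,x); [conj_nbhd] turns it into one
    on d(x,z), after which the triangle inequality applies. *)
Lemma entourage_nbhd U x : U ∈ T -> x ∈ U ->
  exists n, n ∈ omega M /\ forall y, entourage n x y -> y ∈ U.
Proof using hB Xcompact.
  intros HU Hx; destruct (proj2 (proj1 (qu_top hB U) HU) x Hx) as (n & Hn & HnU).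
  assert (HxX : x ∈ X) by (apply (qu_top hB) in HU; now apply HU).
  destruct (ball_ex hB (omegaS Hn) HxX) as (W & HW & HWB).
  destruct (conj_nbhd hB Xcompact HW (y := x)) as (m & Hm & HmW).
  { apply HWB, (qu_refl hB); auto using omegaS. }
  destruct (omega_max (omegaS Hn) Hm) as (k & Hk & Hnk & Hmk).
  exists k; split; auto; intros y (z & Hzx & Hzy); apply HnU.
  apply (qu_tri hB Hn (z := z)).
  - apply HWB, HmW, (qu_le hB Hk Hmk Hzx).
  - exact (qu_le hB Hk Hnk Hzy).
Qed.

(* Compactness replaces the choice of sequences: first the left centre, then
   the right centre is replaced by a cluster point, and both cluster points
   coincide. *)
Lemma entourage_comp m : m ∈ omega M -> exists n, n ∈ omega M /\
  forall x y w, entourage n x y -> entourage n y w -> entourage m x w.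
Proof using hB Xcompact XT2.
  intros Hm; apply NNPP; intros Hno.
  set (Q := fun n z z' => exists x y w,
    B n z x /\ B n z y /\ B n z' y /\ B n z' w /\ ~ entourage m x w).
  assert (HQ : def3 Q) by (unfold Q; defn).
  assert (Hlt : forall n, n ∈ omega M -> n ∈ succ n) by (intros; apply succ_spec; auto).
  assert (Qdec : forall n z z', n ∈ omega M -> Q (succ n) z z' -> Q n z z').
  { intros n z z' Hn (x & y & w & H1 & H2 & H3 & H4 & H5); exists x, y, w.
    repeat split; auto; apply (qu_le hB (m := succ n)); auto using omegaS. }
  (* Moving the left or the right centre to a nearby point costs one index; this is how each centre
     is replaced by a cluster point. *)
  assert (Q1 : forall n z u z', n ∈ omega M -> B (succ n) z u -> Q (succ n) u z' -> Q n z z').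
  { intros n z u z' Hn Hzu (x & y & w & H1 & H2 & H3 & H4 & H5); exists x, y, w.
    repeat split; auto; try (now apply (qu_tri hB Hn (z := u)));
      apply (qu_le hB (m := succ n)); auto using omegaS. }
  assert (Q2 : forall n z u z', n ∈ omega M -> B (succ n) z' u -> Q (succ n) z u -> Q n z z').
  { intros n z u z' Hn Hzu (x & y & w & H1 & H2 & H3 & H4 & H5); exists x, y, w.
    repeat split; auto; try (now apply (qu_tri hB Hn (z := u)));
      apply (qu_le hB (m := succ n)); auto using omegaS. }
  destruct (@cluster M X T T' B hB Xcompact (fun n z => exists z', Q n z z'))
    as (z & Hz & H); [defn| | |].
  - intros n Hn; apply NNPP; intros Hn'; apply Hno; exists n; split; auto.
    intros x y w (z & Hzx & Hzy) (z' & Hzy' & Hzw); apply NNPP; intros Hxw.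
    apply Hn'; exists z; split; [now apply (qu_in hB) in Hzx|].
    exists z', x, y, w; auto.
  - intros n z Hn (z' & H); eauto.
  - destruct (@cluster M X T T' B hB Xcompact (fun n z' => Q n z z'))
      as (z' & Hz' & H'); [defn| |eauto|].
    + intros n Hn; destruct (H _ (omegaS Hn)) as (u & Hu & z' & HQz).
      exists z'; split; [|exact (Q1 _ _ _ _ Hn Hu HQz)].
      destruct HQz as (x & y & w & _ & _ & H3 & _); now apply (qu_in hB) in H3.
    + assert (HQz : forall n, n ∈ omega M -> Q n z z').
      { intros n Hn; destruct (H' _ (omegaS Hn)) as (u & Hu & HQz); eauto. }
      assert (E : z = z').
      { apply NNPP; intros Hne.
        destruct (XT2 Hz Hz' Hne) as (U & W & HU & HW & HzU & HzW & Hdis).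
        destruct (proj2 (proj1 (qu_top hB U) HU) z HzU) as (i & Hi & HiU).
        destruct (proj2 (proj1 (qu_top hB W) HW) z' HzW) as (j & Hj & HjW).
        destruct (omega_max Hi Hj) as (k & Hk & Hik & Hjk).
        destruct (HQz k Hk) as (x & y & w & _ & H2 & H3 & _).
        apply Hdis; exists y; apply inter_spec; split.
        - apply HiU, (qu_le hB Hk Hik H2).
        - apply HjW, (qu_le hB Hk Hjk H3). }
      subst z'; destruct (HQz m Hm) as (x & y & w & H1 & _ & _ & H4 & H5).
      apply H5; exists z; auto.
Qed.

(** The condition [m ∈ n] makes the selected indices strictly increase, so that the subsequence is
    cofinal. *)
Definition refines m n : Prop := m ∈ n /\ forall x y z w,
  entourage n x y -> entourage n y z -> entourage n z w -> entourage m x w.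

Lemma refines_def : def2 refines.
Proof using hB. unfold refines; defn. Qed.
Local Hint Resolve refines_def : defn.

Lemma refines_ex m : m ∈ omega M -> exists n, n ∈ omega M /\ refines m n.
Proof using hB Xcompact XT2.
  intros Hm; destruct (entourage_comp Hm) as (i & Hi & H).
  destruct (entourage_comp Hi) as (j & Hj & H').
  destruct (omega_max Hi Hj) as (k & Hk & Hik & Hjk).
  destruct (omega_max Hk (omegaS Hm)) as (n & Hn & Hkn & Hmn).
  exists n; split; auto; split.
  - assert (Hs : m ∈ succ m) by (apply succ_spec; auto).
    destruct Hmn as [<-|Hmn]; auto; exact (omega_trans Hn Hmn Hs).
  - intros x y z w H1 H2 H3.
    apply (entourage_le Hn Hkn) in H1; apply (entourage_le Hn Hkn) in H2.
    apply (entourage_le Hn Hkn) in H3; apply (H x z).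
    + apply (H' x y); now apply (entourage_le Hk).
    + now apply (entourage_le Hk).
Qed.

(** Taking the least refinement makes the step functional and replaces dependent choice. *)
Definition next_index (k m n : M) : Prop :=
  refines m n /\ forall j, j ∈ n -> ~ refines m j.

Lemma next_index_def : def3 next_index.
Proof using hB. unfold next_index; defn. Qed.
Local Hint Resolve next_index_def : defn.

Lemma next_index_fun k m n n' : k ∈ omega M -> m ∈ omega M -> n ∈ omega M ->
  n' ∈ omega M -> next_index k m n -> next_index k m n' -> n = n'.
Proof using.
  intros _ _ Hn Hn' [H1 H2] [H1' H2'].
  destruct (omega_total Hn Hn') as [h|[h|h]]; auto.
  - now destruct (H2' _ h).
  - now destruct (H2 _ h).
Qed.

Lemma next_index_total k m : k ∈ omega M -> m ∈ omega M ->
  exists n, n ∈ omega M /\ next_index k m n.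
Proof using hB Xcompact XT2.
  intros _ Hm; destruct (@omega_least M (refines m)) as (n & Hn & H & H');
    [defn|now apply refines_ex|].
  exists n; split; [exact Hn|split; auto].
Qed.

Definition index k m : Prop := recrel (omega M) (empty M) next_index k m.

Lemma index_def : def2 index.
Proof using hB. apply recrel_def, next_index_def. Qed.
Local Hint Resolve index_def : defn.

(** Level 0 is all pairs, since 0 is no successor; level j+1 is the entourage of the j-th selected
    index. *)
Definition normal_entourage k x y : Prop := x ∈ X /\ y ∈ X /\
  forall j m, j ∈ omega M -> k = succ j -> index j m -> entourage m x y.

Lemma normal_entourage_spec : normal_sequence X normal_entourage.
Proof using hB Xcompact XT2.
  pose proof (omega0 M) as H0; unfold normal_entourage; constructor.
  - defn.
  - intros k x y (Hx & Hy & _); auto.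
  - intros k x Hx; repeat split; auto; intros j m Hj _ Hm; exists x.
    split; apply (qu_refl hB); auto; apply Hm.
  - intros k x y (Hx & Hy & H); repeat split; auto; intros j m Hj Ek Hm.
    destruct (H j m Hj Ek Hm) as (z & H1 & H2); exists z; auto.
  - intros x y Hx Hy; repeat split; auto; intros j m Hj E.
    symmetry in E; now apply succ_neq0 in E.
  - intros k x y z w Hk (Hx & _ & H1) (_ & _ & H2) (_ & Hw & H3).
    repeat split; auto; intros j m Hj -> Hm.
    destruct (next_index_total Hj (proj1 (proj2 Hm))) as (n & Hn & Hmn).
    pose proof (recrelS Hm Hn Hmn) as Hsn.
    apply (proj2 (proj1 Hmn) x y z w);
      [apply (H1 (succ j))|apply (H2 (succ j))|apply (H3 (succ j))]; auto.
Qed.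

Lemma normal_entourage_ge k : k ∈ omega M ->
  exists n, n ∈ omega M /\ forall x y, entourage n x y -> normal_entourage k x y.
Proof using hB Xcompact XT2.
  intros Hk.
  assert (Hin : forall n x y, entourage n x y -> x ∈ X /\ y ∈ X).
  { intros n x y (z & H1 & H2); apply (qu_in hB) in H1, H2; tauto. }
  destruct (omega_case Hk) as [->|(j & Hj & ->)].
  - exists (empty M); split; [apply omega0|]; intros x y H; apply Hin in H as [Hx Hy].
    now apply (ns_zero normal_entourage_spec).
  - destruct (recrel_total (omega0 M) next_index_def next_index_total Hj) as (m & Hm).
    exists m; split; [apply Hm|]; intros x y H; destruct (Hin _ _ _ H) as [Hx Hy].
    repeat split; auto; intros j' m' Hj' E Hm'; apply succ_inj in E; auto; subst j'.
    now rewrite (recrel_unique (omega0 M) next_index_def next_index_fun Hm' Hm).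
Qed.

Lemma normal_entourage_le n : n ∈ omega M ->
  exists k, k ∈ omega M /\ forall x y, normal_entourage k x y -> entourage n x y.
Proof using hB Xcompact XT2.
  intros Hn; exists (succ n); split; auto using omegaS; intros x y (_ & _ & H).
  destruct (recrel_total (omega0 M) next_index_def next_index_total Hn) as (m & Hm).
  apply (entourage_le (m := m)); [apply Hm| |exact (H n m Hn eq_refl Hm)].
  clear H; revert n m Hm Hn.
  (* The selected indices increase strictly from 0, so the n-th one is at least [n]. *)
  enough (Hle : forall n m, index n m -> n = m \/ n ∈ m) by auto.
  apply (recrel_ind (omega0 M) next_index_def); [defn|auto|].
  intros n m m' Hn H Hm' [[Hmm _] _].
  assert (Hs : succ m = m' \/ succ m ∈ m').
  { pose proof (omegaS_mem Hm' Hmm) as Hs; apply succ_spec in Hs; tauto. }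
  destruct H as [->|H]; auto; right.
  pose proof (omegaS_mem (proj1 (proj2 Hn)) H) as Hs'.
  destruct Hs as [<-|Hs]; auto; exact (omega_trans Hm' Hs Hs').
Qed.

End NormalSequence.

(** * The chain metric *)

Section ChainMetric.
Variables (M : ZF_model) (K : field_data M).
Hypothesis hK : complete_ordered_field K.
Implicit Types x y z u v w n m i j k l r s t S : M.
Variables (X : M) (V : M -> M -> M -> Prop).
Hypothesis hV : normal_sequence X V.

Local Notation R := (Rset K).
Local Notation "x <= y" := (rle K x y).
Local Notation "x < y" := (rlt K x y).
Local Notation hl := (pow2neg K).

Let Vdef := ns_def hV.
Local Hint Resolve Vdef : defn.
Let zeroR := Rzero_in hK.
Local Hint Resolve zeroR omega0 omegaS : core.
Let addR := @radd_in M K hK.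
Let powR := @pow2neg_in M K hK.
Local Hint Resolve addR powR : core.

Definition chain_data k x y r : M := opair (opair k x) (opair y r).

(* A chain of [k] steps from [x] to [y]; a step [V j y z] has length [2^-j], and
   [r] is the sum of the lengths. *)
Definition chain k x y r : Prop :=
  k ∈ omega M /\ x ∈ X /\ y ∈ X /\ r ∈ R /\
  forall S, (forall x, x ∈ X -> chain_data (empty M) x x (Rzero K) ∈ S) ->
    (forall k x y z j r s t, k ∈ omega M -> x ∈ X -> chain_data k x y r ∈ S ->
       V j y z -> opair j s ∈ halves K -> opair (opair r s) t ∈ Radd K ->
       chain_data (succ k) x z t ∈ S) ->
    chain_data k x y r ∈ S.

Lemma chain_def : def4 chain.
Proof using hV. unfold chain, chain_data; defn. Qed.
Local Hint Resolve chain_def : defn.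

Lemma chain0 x : x ∈ X -> chain (empty M) x x (Rzero K).
Proof using hK. intros Hx; repeat split; auto. Qed.

Lemma chainS k x y z j r : j ∈ omega M -> chain k x y r -> V j y z ->
  chain (succ k) x z (radd K r (hl j)).
Proof using hK hV.
  intros Hj (Hk & Hx & Hy & Hr & H) HV.
  repeat split; auto; [now apply (ns_in hV) in HV|].
  intros S H0 HS; apply (HS k x y z j r (hl j)); auto.
  - now apply (pow2neg_graph hK).
  - apply (radd_graph hK); auto.
Qed.

Lemma chain_ind (P : M -> M -> M -> M -> Prop) : def4 P ->
  (forall x, x ∈ X -> P (empty M) x x (Rzero K)) ->
  (forall k x y z j r, chain k x y r -> P k x y r -> j ∈ omega M -> V j y z ->
     P (succ k) x z (radd K r (hl j))) ->
  forall k x y r, chain k x y r -> P k x y r.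
Proof using hK hV.
  intros HP H0 HS k x y r Hc; assert (Hc' := Hc).
  destruct Hc' as (Hk & Hx & Hy & Hr & H).
  destruct (sep (P := fun q => exists k x y r, q = chain_data k x y r /\
      chain k x y r /\ P k x y r)
    (prod (prod (omega M) X) (prod X R))) as [S HSs]; [unfold chain_data; defn|].
  assert (Hin : chain_data k x y r ∈ S).
  { apply H.
    - intros u Hu; apply HSs; split.
      + unfold chain_data; rewrite !prod_opair; auto.
      + exists (empty M), u, u, (Rzero K); auto using chain0.
    - intros k' x' y' z j r' s t Hk' Hx' HS' HV Hs Ht.
      apply (pow2neg_graph hK) in Hs as [Hj ->].
      apply (radd_graph hK) in Ht as (Hr' & _ & ->).
      apply HSs in HS' as (_ & k1 & x1 & y1 & r1 & E & Hc1 & HP1).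
      unfold chain_data in E; apply opair_inj in E as [E E'].
      apply opair_inj in E as [<- <-]; apply opair_inj in E' as [<- <-].
      pose proof (chainS Hj Hc1 HV) as Hc2.
      apply HSs; split.
      + unfold chain_data; rewrite !prod_opair; unfold chain in Hc2; tauto.
      + exists (succ k'), x', z, (radd K r' (hl j)); eauto. }
  apply HSs in Hin as (_ & k1 & x1 & y1 & r1 & E & _ & HP1).
  unfold chain_data in E; apply opair_inj in E as [E E'].
  apply opair_inj in E as [<- <-]; apply opair_inj in E' as [<- <-]; auto.
Qed.

Lemma chain_in k x y r : chain k x y r -> k ∈ omega M /\ x ∈ X /\ y ∈ X /\ r ∈ R.
Proof using. unfold chain; tauto. Qed.

Lemma chain_step j x y : j ∈ omega M -> V j x y -> chain (succ (empty M)) x y (hl j).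
Proof using hK hV.
  intros Hj HV; rewrite <- (radd0l hK (x := hl j)) by auto.
  apply chainS with x; auto; apply chain0; now apply (ns_in hV) in HV.
Qed.

Lemma chain_nonneg k x y r : chain k x y r -> Rzero K <= r.
Proof using hK hV.
  revert k x y r; apply chain_ind; [unfold rle; defn| |].
  - intros x Hx; now apply (rle_refl hK).
  - intros k x y z j r Hc H Hj _; apply (Rle_trans hK) with r; auto.
    apply (rle_addr hK); [now apply chain_in in Hc|now apply (pow2neg_pos hK)].
Qed.

Lemma chain_trans k x y r l z s : chain k x y r -> chain l y z s ->
  exists m, chain m x z (radd K r s).
Proof using hK hV.
  intros H1 H2.
  (* The sum is named through its graph to keep the induction predicate definable. The induction is
     on the second chain because chains grow at their right end. *)
  enough (exists m t, opair (opair r s) t ∈ Radd K /\ chain m x z t) as (m & t & Ht & Hm).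
  { apply (radd_graph hK) in Ht as (_ & _ & ->); eauto. }
  revert l y z s H2 k x r H1.
  apply (@chain_ind (fun l y z s => forall k x r, chain k x y r ->
    exists m t, opair (opair r s) t ∈ Radd K /\ chain m x z t)); [defn| |].
  - intros y Hy k x r H; exists k, r; split; auto; apply (radd_graph hK).
    apply chain_in in H as (_ & _ & _ & Hr); repeat split; auto.
    symmetry; now apply (Radd0 hK).
  - intros l y z w j s Hc IH Hj HV k x r H.
    apply chain_in in Hc as (_ & _ & _ & Hs).
    destruct (IH k x r H) as (m & t & Ht & Hm).
    apply (radd_graph hK) in Ht as (Hr & _ & ->).
    exists (succ m), (radd K (radd K r s) (hl j)); split; [|exact (chainS Hj Hm HV)].
    apply (radd_graph hK); repeat split; auto; symmetry; now apply (RaddA hK); auto.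
Qed.

Lemma chain_sym k x y r : chain k x y r -> exists m, chain m y x r.
Proof using hK hV.
  revert k x y r; apply chain_ind; [defn| |].
  - intros x Hx; exists (empty M); now apply chain0.
  - intros k x y z j r Hc (m & Hm) Hj HV.
    apply chain_in in Hc as (_ & _ & _ & Hr).
    rewrite (RaddC hK) by auto; apply (chain_trans (y := y) (k := succ (empty M)) (l := m)); auto.
    apply chain_step; auto; now apply (ns_sym hV).
Qed.

Lemma chain_zero_inv x y r : chain (empty M) x y r -> x = y /\ r = Rzero K.
Proof using hK hV.
  intros H.
  assert (G : forall k x y r, chain k x y r -> k = empty M -> x = y /\ r = Rzero K).
  { apply (@chain_ind (fun k x y r => k = empty M -> x = y /\ r = Rzero K));
      [defn|auto|].
    intros k u v w j s _ _ _ _ E; now apply succ_neq0 in E. }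
  now apply (G (empty M)).
Qed.

(** The cut is at the first step where the partial sum reaches [t], or at the last step if it never
    does, which leaves a right part of length 0. *)
Lemma chain_split k x y r : chain k x y r -> k <> empty M ->
  forall t, Rzero K < t ->
  exists u v j r1 r2 k1 k2, k1 ∈ k /\ k2 ∈ k /\ j ∈ omega M /\
    chain k1 x u r1 /\ V j u v /\ chain k2 v y r2 /\ r1 < t /\
    r = radd K (radd K r1 (hl j)) r2 /\
    (t <= radd K r1 (hl j) \/ r2 = Rzero K).
Proof using hK hV.
  intros Hc Hk t Ht.
  set (P := fun k x y r => k <> empty M ->
    exists u v j r1 r2 k1 k2, k1 ∈ k /\ k2 ∈ k /\ chain k1 x u r1 /\ V j u v /\
    chain k2 v y r2 /\ r1 < t /\
    exists s s', opair j s ∈ halves K /\ opair (opair r1 s) s' ∈ Radd K /\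
      opair (opair s' r2) r ∈ Radd K /\ (t <= s' \/ r2 = Rzero K)).
  assert (HP : def4 P) by (unfold P, rlt, rle; defn).
  enough (H : P k x y r).
  { destruct (H Hk) as (u & v & j & r1 & r2 & k1 & k2 & H1 & H2 & H3 & H4 & H5 & H6 &
      s & s' & Hs & Hs' & Hr & Ha).
    apply (pow2neg_graph hK) in Hs as [Hj ->].
    apply (radd_graph hK) in Hs' as (_ & _ & ->).
    apply (radd_graph hK) in Hr as (_ & _ & ->).
    exists u, v, j, r1, r2, k1, k2; auto 12. }
  destruct (rlt_in hK Ht) as [_ HtR].
  clear Hk; revert k x y r Hc; apply (chain_ind HP).
  - intros x Hx H; now destruct H.
  - intros k x y z j r Hc IH Hj HV _.
    destruct (chain_in Hc) as (Hk & Hx & Hy & Hr).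
    destruct (rle_or_lt hK HtR Hr) as [Htr|Hrt].
    + destruct IH as (u & v & i & r1 & r2 & k1 & k2 & H1 & H2 & H3 & H4 & H5 & H6 &
        s & s' & Hs & Hs' & Hr' & Ha).
      { intros ->; apply chain_zero_inv in Hc as [_ ->].
        exact (rlt_not_le hK Ht Htr). }
      assert (Hr2 := chain_in H5); destruct Hr2 as (_ & _ & _ & Hr2).
      apply (radd_graph hK) in Hr' as (Hs'R & _ & ->).
      exists u, v, i, r1, (radd K r2 (hl j)), k1, (succ k2).
      split; [|split; [|split; [|split; [|split; [|split]]]]]; auto.
      * apply succ_spec; auto.
      * now apply omegaS_mem.
      * exact (chainS Hj H5 HV).
      * exists s, s'; repeat split; auto.
        -- apply (radd_graph hK); repeat split; auto; symmetry; now apply (RaddA hK); auto.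
        (* If the shorter chain was cut at its end, its whole length is the partial sum, and that
           already reaches [t]. *)
        -- left; destruct Ha as [Ha| ->]; auto; now rewrite (Radd0 hK) in Htr.
    + assert (HzX : z ∈ X) by now apply (ns_in hV) in HV.
      exists y, z, j, r, (Rzero K), k, (empty M).
      split; [|split; [|split; [|split; [|split; [|split]]]]]; auto.
      * apply succ_spec; auto.
      * destruct (omega0_or (omegaS Hk)) as [E|E]; auto; now apply succ_neq0 in E.
      * now apply chain0.
      * exists (hl j), (radd K r (hl j)); repeat split; auto.
        -- now apply (pow2neg_graph hK).
        -- apply (radd_graph hK); auto.
        -- apply (radd_graph hK); repeat split; auto; symmetry; apply (Radd0 hK); auto.
Qed.

Lemma normal_succ k x y : k ∈ omega M -> V (succ k) x y -> V k x y.
Proof using hV.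
  intros Hk H; destruct (ns_in hV H) as [Hx Hy].
  apply (ns_comp hV Hk (y := x) (z := x)); auto; now apply (ns_refl hV).
Qed.

Lemma normal_le n m x y : m ∈ omega M -> (n = m \/ n ∈ m) -> V m x y -> V n x y.
Proof using hV.
  intros Hm [->|Hn]; auto.
  apply (@omega_mono M (fun m => V m x y -> V n x y)) with n; auto; [defn|].
  intros k Hk IH H; apply IH; now apply normal_succ.
Qed.

(* Frink's lemma: cut a chain of length less than [2^-n] at the step that
   passes [2^-(n+1)]. *)
Lemma chain_entourage k : k ∈ omega M -> forall x y r, chain k x y r ->
  forall n, n ∈ omega M -> r < hl n -> V n x y.
Proof using hK hV.
  intros Hk x y r Hc n Hn Hr.
  enough (H : forall x y r, chain k x y r -> forall n h, opair n h ∈ halves K ->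
    r < h -> V n x y).
  { apply (H x y r Hc n (hl n)); auto; now apply (pow2neg_graph hK). }
  clear x y r Hc n Hn Hr; revert k Hk.
  apply (@omega_strong_ind M (fun k => forall x y r, chain k x y r ->
    forall n h, opair n h ∈ halves K -> r < h -> V n x y)).
  { unfold rlt, rle; defn. }
  intros k Hk IH x y r Hc n h Hh Hr.
  apply (pow2neg_graph hK) in Hh as [Hn ->].
  destruct (classic (k = empty M)) as [->|Hk0].
  { apply chain_zero_inv in Hc as Hc'; destruct Hc' as [<- _].
    apply (ns_refl hV); now apply chain_in in Hc. }
  assert (Hpos := pow2neg_pos hK (omegaS Hn)).
  destruct (chain_split Hc Hk0 Hpos) as
    (u & v & j & r1 & r2 & k1 & k2 & H1 & H2 & Hj & H3 & H4 & H5 & H6 & Er & Ha).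
  assert (Hgr : opair (succ n) (hl (succ n)) ∈ halves K)
    by (apply (pow2neg_graph hK); auto).
  destruct (chain_in H3) as (_ & _ & _ & Hr1), (chain_in H5) as (_ & _ & _ & Hr2).
  apply (ns_comp hV Hn (y := u) (z := v)).
  - apply (IH k1 H1 x u r1 H3 _ _ Hgr H6).
  - apply (normal_le (m := j)); auto.
    assert (Hjr : hl j < hl n).
    { apply (rle_lt_trans hK) with r; auto; rewrite Er.
      apply (Rle_trans hK) with (radd K r1 (hl j)).
      - rewrite (RaddC hK) by auto; apply (rle_addr hK); auto.
        now apply (chain_nonneg H3).
      - apply (rle_addr hK); auto; now apply (chain_nonneg H5). }
    destruct (omega_total Hj Hn) as [h|[->|h]].
    + destruct (rlt_not_le hK Hjr); now apply (pow2neg_lt hK).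
    + now destruct Hjr.
    + pose proof (omegaS_mem Hj h) as Hs; apply succ_spec in Hs; tauto.
  - apply (IH k2 H2 v y r2 H5 _ _ Hgr).
    (* The left part and the step together use up 2^-(n+1) of a total below 2^-n, so less than
       2^-(n+1) remains. *)
    destruct Ha as [Ha| ->]; [|exact Hpos].
    destruct (rle_or_lt hK (pow2neg_in hK (omegaS Hn)) Hr2) as [h|h]; auto.
    destruct (rlt_not_le hK Hr); rewrite Er, <- (pow2neg_double hK Hn).
    now apply (rle_add2 hK).
Qed.

Definition chain_inf x y s : Prop := s ∈ R /\
  (forall k r, chain k x y r -> s <= r) /\
  forall l, l ∈ R -> (forall k r, chain k x y r -> l <= r) -> l <= s.

Lemma chain_inf_unique x y s s' : chain_inf x y s -> chain_inf x y s' -> s = s'.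
Proof using hK.
  intros (Hs & H1 & H2) (Hs' & H1' & H2'); apply (Rle_antisym hK); auto.
Qed.

Lemma chain_inf_ex x y : x ∈ X -> y ∈ X -> exists s, chain_inf x y s.
Proof using hK hV.
  intros Hx Hy.
  destruct (sep (P := fun r => exists k, chain k x y r) R) as [a Ha]; [defn|].
  assert (Ha' : forall k r, chain k x y r -> r ∈ a).
  { intros k r H; apply Ha; split; eauto; now apply chain_in in H. }
  destruct (inf_ex hK (a := a)) as (s & Hs & H1 & H2).
  - intros r Hr; now apply Ha in Hr.
  - exists (hl (empty M)); apply (Ha' (succ (empty M))), chain_step; auto.
    now apply (ns_zero hV).
  - intros r Hr; apply Ha in Hr as (_ & k & Hk); exact (chain_nonneg Hk).
  - exists s; split; [exact Hs|split; eauto].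
    intros l Hl H; apply H2; auto; intros r Hr; apply Ha in Hr as (_ & k & Hk); eauto.
Qed.

Lemma chain_inf_nonneg x y s : chain_inf x y s -> Rzero K <= s.
Proof using hK hV.
  intros (_ & _ & H); apply H; auto; intros k r; apply chain_nonneg.
Qed.

Lemma chain_inf_sym x y s : chain_inf x y s -> chain_inf y x s.
Proof using hK hV.
  intros (Hs & H1 & H2); split; [exact Hs|split].
  - intros k r H; apply chain_sym in H as (m & H); eauto.
  - intros l Hl H; apply H2; auto; intros k r Hc.
    apply chain_sym in Hc as (m & Hc); eauto.
Qed.

Lemma chain_inf_lt x y s t : chain_inf x y s -> s < t ->
  exists k r, chain k x y r /\ r < t.
Proof using hK.
  intros (Hs & H1 & H2) Hst; destruct (rlt_in hK Hst) as [_ Ht].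
  apply NNPP; intros Hno; apply (rlt_not_le hK Hst), H2; auto; intros k r Hc.
  destruct (rle_or_lt hK (x := t) (y := r)); auto; [now apply chain_in in Hc|].
  destruct Hno; eauto.
Qed.

Lemma chain_inf_triangle x y z s1 s2 s : chain_inf x z s1 -> chain_inf z y s2 ->
  chain_inf x y s -> s <= radd K s1 s2.
Proof using hK hV.
  intros H1 H2 (Hs & H & _); assert (R1 := proj1 H1); assert (R2 := proj1 H2).
  destruct (rle_or_lt hK Hs (radd_in hK R1 R2)) as [h|h]; auto; exfalso.
  destruct (rlt_gap hK h) as (t & Ht & Et).
  destruct (rlt_in hK Ht) as [_ HtR].
  destruct (rhalf_ex hK HtR) as (e & He & Ee).
  assert (He0 : Rzero K < e).
  { destruct (rle_or_lt hK He zeroR) as [h'|h']; auto.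
    destruct (rlt_not_le hK Ht); rewrite <- Ee, <- (Radd0 hK zeroR).
    now apply (rle_add2 hK). }
  assert (Hlt : forall a, a ∈ R -> a < radd K a e).
  { intros a Ha; rewrite <- (Radd0 hK Ha) at 1; now apply (rlt_add_l hK). }
  destruct (chain_inf_lt H1 (Hlt s1 R1)) as (k1 & r1 & Hc1 & Hr1).
  destruct (chain_inf_lt H2 (Hlt s2 R2)) as (k2 & r2 & Hc2 & Hr2).
  destruct (chain_trans Hc1 Hc2) as (k & Hc).
  apply (rlt_not_le hK (rlt_add2 hK Hr1 Hr2)).
  replace (radd K (radd K s1 e) (radd K s2 e)) with s; [eauto|].
  rewrite <- Et, <- Ee, !(RaddA hK) by auto; f_equal.
  rewrite <- !(RaddA hK) by auto; f_equal; apply (RaddC hK); auto.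
Qed.

Lemma Rnonneg_spec x : x ∈ Rnonneg K <-> x ∈ R /\ Rzero K <= x.
Proof using.
  apply (@compr_sep M (fun x => x ∈ R /\ Rzero K <= x) R); [unfold rle; defn|tauto].
Qed.

(** One-step chains give the first estimate and Frink's lemma the second; together they say that the
    metric induces the uniformity of [V]. *)
Lemma chain_metric :
  (forall x y, x ∈ X -> y ∈ X -> (forall n, n ∈ omega M -> V n x y) -> x = y) ->
  exists d, metric K X d /\
    (forall x y n, n ∈ omega M -> V n x y -> dist d x y <= hl n) /\
    (forall x y n, n ∈ omega M -> x ∈ X -> y ∈ X -> dist d x y < hl n -> V n x y).
Proof using hK hV.
  intros Hsep.
  destruct (@fun_ex M (fun p s => exists x y, p = opair x y /\ chain_inf x y s)
    (prod X X) (Rnonneg K)) as (d & Hd & Hd').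
  - unfold chain_inf, rle; defn.
  - intros p Hp; apply prod_spec in Hp as (x & y & Hx & Hy & ->).
    destruct (chain_inf_ex Hx Hy) as [s Hs]; exists s; split; eauto.
    apply Rnonneg_spec; split; [apply Hs|exact (chain_inf_nonneg Hs)].
  - intros p s s' _ _ _ (x & y & -> & Hs) (x' & y' & E & Hs').
    apply opair_inj in E as [<- <-]; exact (chain_inf_unique Hs Hs').
  - assert (Hdist : forall x y, x ∈ X -> y ∈ X -> chain_inf x y (dist d x y)).
    { intros x y Hx Hy; assert (Hp : opair x y ∈ prod X X) by now apply prod_opair.
      apply (app_opair Hd) in Hp; apply Hd' in Hp as (_ & _ & x' & y' & E & H).
      now apply opair_inj in E as [<- <-]. }
    assert (Hlt : forall x y n, n ∈ omega M -> x ∈ X -> y ∈ X ->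
      dist d x y < hl n -> V n x y).
    { intros x y n Hn Hx Hy H.
      destruct (chain_inf_lt (Hdist x y Hx Hy) H) as (k & r & Hc & Hr).
      apply (chain_entourage (proj1 (chain_in Hc)) Hc Hn Hr). }
    exists d; split; [split; [split; [exact Hd|split; [|split]]|]|split].
    + intros x Hx; destruct (Hdist x x Hx Hx) as (_ & H & H').
      apply (Rle_antisym hK); [now apply (H (empty M)), chain0|].
      apply H'; auto; intros k r; apply chain_nonneg.
    + intros x y z Hx Hy Hz; apply (chain_inf_triangle (x := x) (y := y) (z := z)); auto.
    + intros x y Hx Hy E; apply Hsep; auto; intros n Hn; apply Hlt; auto.
      rewrite E; now apply (pow2neg_pos hK).
    + intros x y Hx Hy; apply (chain_inf_unique (x := x) (y := y)); auto.
      now apply chain_inf_sym, Hdist.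
    + intros x y n Hn H; destruct (ns_in hV H) as [Hx Hy].
      apply (proj1 (proj2 (Hdist x y Hx Hy)) (succ (empty M))), chain_step; auto.
    + exact Hlt.
Qed.

End ChainMetric.

(** * Quasi-metric spaces *)

Section QuasiMetric.
Variables (M : ZF_model) (K : field_data M).
Hypothesis hK : complete_ordered_field K.
Implicit Types x y z u v w n m r d X T U V : M.

Local Notation R := (Rset K).
Local Notation "x <= y" := (rle K x y).
Local Notation "x < y" := (rlt K x y).
Local Notation hl := (pow2neg K).

Section FixedQuasiMetric.
Variables X d : M.
Hypothesis hd : quasi_metric K X d.

(** Distance and radius enter through their graphs, which makes the relation definable. *)
Definition close n x y : Prop := n ∈ omega M /\
  exists r h, opair (opair x y) r ∈ d /\ opair n h ∈ halves K /\ r < h.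

Lemma close_def : def3 close.
Proof using. unfold close, rlt, rle; defn. Qed.

Lemma dist_nonneg x y : x ∈ X -> y ∈ X -> dist d x y ∈ R /\ Rzero K <= dist d x y.
Proof using hK hd.
  intros Hx Hy; apply Rnonneg_spec, (app_in (proj1 hd)); now apply prod_opair.
Qed.

Lemma close_spec n x y : close n x y <->
  n ∈ omega M /\ x ∈ X /\ y ∈ X /\ dist d x y < hl n.
Proof using hK hd.
  split.
  - intros (Hn & r & h & Hr & Hh & Hlt).
    destruct (fun_dom (proj1 hd) Hr) as [Hxy _]; apply prod_opair in Hxy as [Hx Hy].
    apply (pow2neg_graph hK) in Hh as [_ ->]; repeat split; auto;
      unfold dist; rewrite (app_eq (proj1 hd) Hr); apply Hlt.
  - intros (Hn & Hx & Hy & Hlt); split; auto; exists (dist d x y), (hl n).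
    split; [|split; [|exact Hlt]].
    + apply (app_opair (proj1 hd)); now apply prod_opair.
    + now apply (pow2neg_graph hK).
Qed.

Lemma ball_spec x n : n ∈ omega M -> x ∈ X ->
  forall y, y ∈ ball K X d x n <-> y ∈ X /\ dist d x y < hl n.
Proof using hK hd.
  intros Hn Hx; apply compr_spec; pose proof close_def.
  destruct (sep (P := fun y => close n x y) X) as [b Hb]; [defn|].
  exists b; intros y; rewrite Hb, close_spec; tauto.
Qed.

Lemma tau_spec V : V ∈ tau K X d <-> subset V X /\
  forall x, x ∈ V -> exists n, n ∈ omega M /\ forall y, close n x y -> y ∈ V.
Proof using hK hd.
  pose proof close_def.
  destruct (sep (P := fun V => forall x, x ∈ V -> exists n, n ∈ omega M /\
    forall y, close n x y -> y ∈ V) (power X)) as [a Ha]; [defn|].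
  assert (E : forall V, V ∈ a <-> subset V X /\ forall x, x ∈ V ->
    exists n, n ∈ omega M /\ subset (ball K X d x n) V).
  { intros W; rewrite Ha, power_spec; split; intros [HW HW']; split; auto;
      intros x Hx; destruct (HW' x Hx) as (n & Hn & Hsub); exists n; split; auto;
      intros y Hy; apply Hsub.
    - apply ball_spec in Hy; auto; apply close_spec; intuition.
    - apply ball_spec; auto; apply close_spec in Hy; tauto. }
  unfold tau; rewrite (compr_spec (ex_intro _ a E)), <- E, Ha, power_spec; reflexivity.
Qed.

Lemma conjugate_spec p : p ∈ conjugate X d <->
  exists x y, x ∈ X /\ y ∈ X /\ p = opair (opair x y) (dist d y x).
Proof using hK hd.
  apply compr_spec.
  destruct (sep (P := fun p => exists x y r, opair (opair y x) r ∈ d /\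
    p = opair (opair x y) r) (prod (prod X X) (Rnonneg K))) as [a Ha]; [defn|].
  exists a; intros q; rewrite Ha; split.
  - intros (_ & x & y & r & Hr & ->).
    destruct (fun_dom (proj1 hd) Hr) as [Hxy _]; apply prod_opair in Hxy as [Hy Hx].
    exists x, y; repeat split; auto; unfold dist; now rewrite (app_eq (proj1 hd) Hr).
  - intros (x & y & Hx & Hy & ->); split.
    + rewrite !prod_opair, Rnonneg_spec; auto using dist_nonneg.
    + exists x, y, (dist d y x); split; auto; apply (app_opair (proj1 hd)).
      now apply prod_opair.
Qed.

Lemma conjugate_fun : is_fun (conjugate X d) (prod X X) (Rnonneg K).
Proof using hK hd.
  split.
  - intros p Hp; apply conjugate_spec in Hp as (x & y & Hx & Hy & ->).
    rewrite !prod_opair, Rnonneg_spec; auto using dist_nonneg.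
  - intros p Hp; apply prod_spec in Hp as (x & y & Hx & Hy & ->).
    exists (dist d y x); split; [apply conjugate_spec; eauto|].
    intros r Hr; apply conjugate_spec in Hr as (x' & y' & _ & _ & E).
    apply opair_inj in E as [E ->]; now apply opair_inj in E as [-> ->].
Qed.

Lemma dist_conjugate x y : x ∈ X -> y ∈ X -> dist (conjugate X d) x y = dist d y x.
Proof using hK hd.
  intros Hx Hy; apply (app_eq conjugate_fun), conjugate_spec; eauto.
Qed.

Lemma dist_triangle x y z : x ∈ X -> y ∈ X -> z ∈ X ->
  dist d x y <= radd K (dist d x z) (dist d z y).
Proof using hd. apply hd. Qed.

End FixedQuasiMetric.

Lemma conjugate_quasi_metric X d : quasi_metric K X d ->
  quasi_metric K X (conjugate X d).
Proof using hK.
  intros hd; split; [exact (conjugate_fun hd)|split; [|split]].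
  - intros x Hx; rewrite (dist_conjugate hd) by auto; exact (proj1 (proj2 hd) x Hx).
  - intros x y z Hx Hy Hz; rewrite !(dist_conjugate hd) by auto.
    rewrite (RaddC hK); try (now apply (dist_nonneg hd)).
    now apply (dist_triangle hd).
  - intros x y Hx Hy; rewrite (dist_conjugate hd) by auto; intros E.
    symmetry; exact (proj2 (proj2 (proj2 hd)) y x Hy Hx E).
Qed.

Lemma close_conjugate X d n x y : quasi_metric K X d ->
  (close (conjugate X d) n x y <-> close d n y x).
Proof using hK.
  intros hd; rewrite (close_spec (conjugate_quasi_metric hd)), (close_spec hd).
  split; intros (Hn & Hx & Hy & H); rewrite (dist_conjugate hd) in *; auto.
Qed.

Lemma quasi_metric_uniform X d : quasi_metric K X d ->
  quasi_uniform X (tau K X d) (tau K X (conjugate X d)) (close d).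
Proof using hK.
  intros hd.
  assert (Hin : forall x y, x ∈ X -> y ∈ X -> dist d x y ∈ R)
    by (intros; now apply (dist_nonneg hd)).
  (* A strict inequality leaves room for some 2^-m; this makes balls open on either side. *)
  assert (Hgap : forall x y n, x ∈ X -> y ∈ X -> dist d x y < hl n -> exists m,
    m ∈ omega M /\ radd K (dist d x y) (hl m) < hl n).
  { intros x y n Hx Hy H; destruct (rlt_gap hK H) as (t & Ht & <-).
    destruct (archimedean hK Ht) as (m & Hm & Hmt); exists m; split; auto.
    now apply (rlt_add_l hK); auto. }
  constructor.
  - apply close_def.
  - intros n x y H; apply (close_spec hd) in H; tauto.
  - intros n x Hn Hx; apply (close_spec hd); repeat split; auto;
      rewrite (proj1 (proj2 hd)); auto; now apply (pow2neg_pos hK).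
  - intros n x y z Hn H1 H2; apply (close_spec hd) in H1, H2.
    destruct H1 as (_ & Hx & Hz & H1), H2 as (_ & _ & Hy & H2).
    apply (close_spec hd); split; [|split; [|split]]; auto.
    apply (rle_lt_trans hK) with (1 := dist_triangle hd Hx Hy Hz).
    rewrite <- (pow2neg_double hK Hn); now apply (rlt_add2 hK).
  - intros n x y H; apply (close_spec hd) in H as (Hn & Hx & Hy & H).
    destruct (Hgap x y n Hx Hy H) as (m & Hm & Hlt); exists m; split; auto.
    intros z Hz; apply (close_spec hd) in Hz as (_ & _ & Hz & H').
    apply (close_spec hd); split; [|split; [|split]]; auto.
    apply (rle_lt_trans hK) with (1 := dist_triangle hd Hx Hz Hy).
    apply (rle_lt_trans hK) with (2 := Hlt), (rle_add_l hK); auto; apply H'.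
  - intros n x y H; apply (close_spec hd) in H as (Hn & Hx & Hy & H).
    destruct (Hgap x y n Hx Hy H) as (m & Hm & Hlt); exists m; split; auto.
    intros z Hz; apply (close_spec hd) in Hz as (_ & Hz & _ & H').
    apply (close_spec hd); split; [|split; [|split]]; auto.
    apply (rle_lt_trans hK) with (1 := dist_triangle hd Hz Hy Hx).
    apply (rle_lt_trans hK) with (2 := Hlt).
    pose proof (pow2neg_in hK Hm).
    rewrite (RaddC hK (x := dist d x y)) by auto.
    apply (Rle_add hK); auto; apply H'.
  - intros x y Hx Hy H; apply (proj2 (proj2 (proj2 hd)) x y Hx Hy).
    destruct (dist_nonneg hd Hx Hy) as [HR H0].
    apply (Rle_antisym hK); auto.
    destruct (rle_or_lt hK HR (Rzero_in hK)) as [h|h]; auto; exfalso.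
    destruct (archimedean hK h) as (n & Hn & Hlt).
    specialize (H n Hn); apply (close_spec hd) in H as (_ & _ & _ & H).
    apply (rlt_not_le hK Hlt), H.
  - intros V; apply (tau_spec hd).
  - intros V; rewrite (tau_spec (conjugate_quasi_metric hd)).
    split; intros [HV H]; split; auto; intros x Hx;
      destruct (H x Hx) as (n & Hn & HnV); exists n; split; auto;
      intros y Hy; apply HnV; now apply (close_conjugate n _ _ hd).
Qed.

(* The topology of a compact Hausdorff quasi-metric space is given by the
   uniformity of the [entourage n], which has a countable base. *)
Lemma quasi_metric_metrizable X d : quasi_metric K X d ->
  compact X (tau K X d) -> hausdorff X (tau K X d) -> metrizable K X (tau K X d).
Proof using hK.
  intros hd Hcomp HT2; set (T := tau K X d).
  pose proof (quasi_metric_uniform hd) as hB.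
  pose proof (normal_entourage_spec hB Hcomp HT2) as hV.
  destruct (chain_metric hK hV) as (e & He & He1 & He2).
  - intros x y Hx Hy H; apply NNPP; intros Hne.
    destruct (HT2 x y Hx Hy Hne) as (U & W & HU & HW & HxU & HyW & Hdis).
    destruct (entourage_nbhd hB Hcomp HU HxU) as (n & Hn & HnU).
    destruct (normal_entourage_le hB Hcomp HT2 Hn) as (k & Hk & Hkn).
    apply Hdis; exists y; apply inter_spec; split; auto.
  - exists e; split; [exact He|]; apply set_ext; intros V.
    rewrite (tau_spec (proj1 He)); split.
    + intros HV; split; [now apply (qu_top hB) in HV|]; intros x Hx.
      assert (HxX : x ∈ X) by (apply (qu_top hB) in HV; now apply HV).
      destruct (entourage_nbhd hB Hcomp HV Hx) as (n & Hn & HnV).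
      destruct (normal_entourage_le hB Hcomp HT2 Hn) as (k & Hk & Hkn).
      exists k; split; auto; intros y Hy.
      apply (close_spec (proj1 He)) in Hy as (_ & _ & Hy & Hlt); auto.
    + intros [HVX HV]; apply (qu_top hB); split; auto; intros x Hx.
      destruct (HV x Hx) as (n & Hn & HnV).
      (* The metric estimate is only d <= 2^-(n+1), so one extra index yields the strict bound d <
         2^-n. The point [x] itself later serves as the common centre. *)
      destruct (normal_entourage_ge hB Hcomp HT2 (omegaS Hn)) as (m & Hm & Hmn).
      exists m; split; auto; intros y Hy; apply HnV.
      destruct (qu_in hB Hy) as (_ & HxX & HyX).
      apply (close_spec (proj1 He)); repeat split; auto;
        apply (rle_lt_trans hK) with (hl (succ n));
        try (apply (pow2neg_lt hK); [auto using omegaS|apply succ_spec; auto]);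
        apply He1; auto using omegaS; apply Hmn; exists x; split; auto;
        now apply (qu_refl hB).
Qed.

End QuasiMetric.
Unset Implicit Arguments.

Theorem theorem4p6 (M : ZF_model) (K : field_data M)
    (hK : complete_ordered_field K) :
  (* (a) *)
  (forall X d : M,
     quasi_metric K X d ->
     compact X (tau K X d) -> hausdorff X (tau K X d) ->
     let T := tau K X d in
     let T' := tau K X (conjugate X d) in
     (loeb X T <-> separable X T') /\
     (loeb X T <-> (separable X T /\ separable X T')) /\
     (loeb X T <-> second_countable T)) /\
  (forall X T : M,
     is_topology X T -> compact X T -> hausdorff X T ->
     quasi_metrizable K X T -> loeb X T -> metrizable K X T) /\
  (* (b) *)
  (CAC M ->
   forall X T : M,
     is_topology X T -> compact X T -> hausdorff X T ->
     quasi_metrizable K X T -> metrizable K X T).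
Proof.
  assert (Hmetr : forall X T, compact X T -> hausdorff X T ->
    quasi_metrizable K X T -> metrizable K X T).
  { intros X T Hc H2 (d & hd & ->); exact (quasi_metric_metrizable hK hd Hc H2). }
  split; [|split]; [|intros; now apply Hmetr|intros; now apply Hmetr].
  intros X d hd Hc H2 T T'.
  pose proof (quasi_metric_uniform hK hd) as hB.
  (* The implications form the cycle (i), (ii), (iv), (i); separability passing from the conjugate
     adds (iii). *)
  pose proof (conj_separable_of_loeb hB Hc).
  pose proof (separable_of_conj hB Hc).
  pose proof (second_countable_of_conj hB Hc).
  pose proof (loeb_of_second_countable hB Hc H2).
  unfold T, T'; tauto.
Qed.
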